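(* Fix $n\ge 2$ and $m=2n$. Let $X_{m-1}\subset\mathbb{P}^{m-1}$ be the hypersurface defined by $e_{m-1}(x_1,\dots,x_m)=0$, and let $F_{n-1}(X_{m-1})$ be the Fano scheme of projective $(n-1)$-dimensional linear subspaces contained in $X_{m-1}$. Then $F_{n-1}(X_{m-1})$ contains: (1) $(m-1)!!=m!/(2^n n!)$ isolated closed points, corresponding to the linear spaces of the form $x_{a_1}+x_{b_1}=x_{a_2}+x_{b_2}=\dots=x_{a_n}+x_{b_n}=0$ determined by the perfect matchings $\{\{a_1,b_1\},\dots,\{a_n,b_n\}\}$ of $\{1,\dots,m\}$; (2) $\binom{m}{2}$ irreducible components isomorphic to the Grassmannian $G(n,m-2)$, each consisting of the projective $(n-1)$-dimensional linear spaces contained in a projective $(m-3)$-dimensional linear subspace defined by the vanishing of two of the coordinates.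
   Context: Here $e_{m-1}$ is the elementary symmetric polynomial of degree $m-1$ in $m$ variables, and varieties are considered over $\mathbb{R}$. For a projective variety $X\subset\mathbb{P}^{m-1}$, the Fano scheme $F_{k-1}(X)\subset G(k,m)$ is the closed subscheme of the Grassmannian of $k$-dimensional subspaces of an $m$-dimensional vector space parametrizing projective $(k-1)$-dimensional linear subspaces contained in $X$. Irreducible components in (2) are taken with their reduced structure. *)

(* Defs.v *)
From HB Require Import structures.
From mathcomp Require Import all_boot all_order all_algebra.
From mathcomp Require Import boolp classical_sets functions cardinality reals.
From mathcomp Require Import topology.
From mathcomp Require Export mpoly.

Set Implicit Arguments.
Unset Strict Implicit.
Unset Printing Implicit Defensive.

Import GRing.Theory.
Local Open Scope classical_set_scope.
Local Open Scope ring_scope.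

Section Projective.
Variable K : fieldType.

(* P^(N-1) = Proj K[X_0, .., X_(N-1)]: its points, closed or not, are the
   homogeneous prime ideals that do not contain all the variables. *)
Record projPoint (N : nat) := ProjPoint {
  pt_ideal : set {mpoly K[N]};
  _ : pt_ideal 0;
  _ : forall g h, pt_ideal g -> pt_ideal h -> pt_ideal (g + h);
  _ : forall g h, pt_ideal h -> pt_ideal (g * h);
  _ : forall g h, pt_ideal (g * h) -> pt_ideal g \/ pt_ideal h;
  _ : forall h d, pt_ideal h -> pt_ideal (pihomog mdeg d h);
  _ : exists i : 'I_N, ~ pt_ideal 'X_i
}.

HB.instance Definition _ N := gen_eqMixin (projPoint N).
HB.instance Definition _ N := gen_choiceMixin (projPoint N).

(* The underlying space of the closed subscheme defined by G, when G is a
   homogeneous ideal. The points being homogeneous, an arbitrary G has the same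
   zeros as the homogeneous ideal generated by the components of its members. *)
Definition zeros N (G : set {mpoly K[N]}) : set (projPoint N) :=
  [set p | G `<=` pt_ideal p].

Definition zariski_open N (U : set (projPoint N)) :=
  exists G : set {mpoly K[N]}, U = ~` zeros G.

Lemma zariski_openT N : zariski_open (@setT (projPoint N)).
Proof.
exists setT; rewrite -[LHS]setCK setCT; congr (~` _).
by rewrite eqEsubset; split=> // -[p ? ? ? ? ? [i Hi]] /= /(_ 'X_i I).
Qed.

Lemma zariski_openI N : setI_closed (@zariski_open N).
Proof.
move=> _ _ [G ->] [H ->].
exists [set f | exists2 g, G g & exists2 h, H h & f = g * h].
rewrite -setCU; congr (~` _); rewrite eqEsubset; split=> p.
  case: p => p p0 pD pM pP ph pi /= [] Hp f [g Gg [h Hh ->]] /=.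
    by rewrite mulrC; apply/pM/Hp.
  exact/pM/Hp.
move=> Hp; apply: contrapT => /not_orP[/existsNP[g]] /not_implyP[Gg npg].
move=> /existsNP[h] /not_implyP[Hh nph].
have : pt_ideal p (g * h) by apply: Hp; exists g => //; exists h.
by case: p npg nph {Hp} => p p0 pD pM pP ph pi /= npg nph /pP[].
Qed.

Lemma zariski_open_bigU N (J : Type) (f : J -> set (projPoint N)) :
  (forall i, zariski_open (f i)) -> zariski_open (\bigcup_i f i).
Proof.
move=> /choice[G fE]; exists (\bigcup_i G i).
rewrite -[LHS]setCK setC_bigcup; congr (~` _).
rewrite eqEsubset; split=> p Hp.
  by move=> g [i _ Gg]; have := Hp i I; rewrite fE setCK; apply.
by move=> i _; rewrite fE setCK => g Gg; apply: Hp; exists i.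
Qed.

HB.instance Definition _ N := isOpenTopological.Build (projPoint N)
  (@zariski_openT N) (@zariski_openI N) (@zariski_open_bigU N).

(* The homogeneous ideal of the reduced structure on a closed subset Z. *)
Definition vanishing_ideal N (Z : set (projPoint N)) : set {mpoly K[N]} :=
  [set h | forall p, Z p -> pt_ideal p h].

(* A K-morphism between closed subsets Z and W with their reduced structure,
   given by tuples of forms of equal degree: each tuple represents the morphism
   wherever it does not vanish, these loci cover Z, and any two tuples are
   proportional on Z. Over a field that is not algebraically closed, a map on
   the underlying points would not determine the morphism. *)
Definition regular_map N M (Z : set (projPoint N)) (W : set (projPoint M))
    (Phi : set (M.-tuple {mpoly K[N]})) :=
  [/\ forall g, Phi g -> exists d, forall j, tnth g j \is d.-homog,
      forall p, Z p -> exists2 g, Phi g & exists j, ~ pt_ideal p (tnth g j),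
      forall g g', Phi g -> Phi g' -> forall i j,
        vanishing_ideal Z (tnth g i * tnth g' j - tnth g j * tnth g' i)
    & forall g h, Phi g -> vanishing_ideal W h -> vanishing_ideal Z (h \mPo g)].

Definition inverse_on N M (Z : set (projPoint N))
    (Phi : set (M.-tuple {mpoly K[N]})) (Psi : set (N.-tuple {mpoly K[M]})) :=
  forall g h, Phi g -> Psi h -> forall i j, vanishing_ideal Z
    ((tnth h i \mPo g) * 'X_j - (tnth h j \mPo g) * 'X_i).

Definition reduced_iso N M (Z : set (projPoint N)) (W : set (projPoint M)) :=
  exists Phi Psi, [/\ regular_map Z W Phi, regular_map W Z Psi,
    inverse_on Z Phi Psi & inverse_on W Psi Phi].

End Projective.

Definition irreducible_set (T : topologicalType) (Z : set T) :=
  Z !=set0 /\ forall A B, closed A -> closed B ->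
    Z `<=` A `|` B -> Z `<=` A \/ Z `<=` B.

Definition irreducible_component (T : topologicalType) (X Z : set T) :=
  [/\ Z `<=` X, irreducible_set Z
    & forall Y, irreducible_set Y -> Y `<=` X -> Z `<=` Y -> Y = Z].

Definition ideal_span (A : comNzRingType) (G : set A) : set A :=
  [set x | exists2 s : seq (A * A),
     (forall u, u \in s -> G u.2) & x = \sum_(u <- s) u.1 * u.2].

Section Grassmannian.
Variables (K : fieldType) (k m : nat).

(* Column selections of the maximal minors: increasing maps 'I_k -> 'I_m. *)
Definition plucker_idx : {set {ffun 'I_k -> 'I_m}} :=
  [set s : {ffun 'I_k -> 'I_m} |
    [forall i : 'I_k, forall j : 'I_k, (i < j)%N ==> (s i < s j)%N]]%SET.

Definition plucker_dim := #|plucker_idx|.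

Definition plucker (A : comNzRingType) (X : 'M[A]_(k, m)) :
    plucker_dim.-tuple A :=
  [tuple \det (colsub (enum_val a) X) | a < plucker_dim].

Definition generic_mx : 'M[{mpoly K[k * m]}]_(k, m) :=
  \matrix_(i, j) 'X_(mxvec_index i j).

(* The coordinate ring of the Plucker embedding is the algebra generated by the
   maximal minors of the generic matrix. *)
Definition plucker_ideal : set {mpoly K[plucker_dim]} :=
  [set h | h \mPo plucker generic_mx = 0].

(* G(k, m), in its Plucker embedding in the P^(plucker_dim - 1). *)
Definition grassmannian : set (projPoint K plucker_dim) := zeros plucker_ideal.

(* f (t X), for the generic matrix X and a row t of k further variables: the
   restriction of f to the row space of X. *)
Definition generic_restriction (f : {mpoly K[m]}) :
    {mpoly {mpoly K[k * m]}[k]} :=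
  map_mpoly (@mpolyC (k * m) K) f
    \mPo [tuple \sum_i (generic_mx i j)%:MP * 'X_i | j < m].

(* For X the subscheme of P^(m-1) defined by the forms in G, the conditions on
   the entries of a k x m matrix for its row space to lie in X. *)
Definition stiefel_ideal (G : set {mpoly K[m]}) : set {mpoly K[k * m]} :=
  ideal_span [set c | exists2 f, G f & exists a, c = (generic_restriction f)@_a].

(* The homogeneous ideal, in the Plucker coordinates, of the Fano scheme
   F_(k-1)(X) as a closed subscheme of G(k, m). The matrices of rank k form a
   GL_k-torsor over G(k, m), so the ideal sheaf of F_(k-1)(X) consists of the
   functions whose pullback lies in stiefel_ideal. *)
Definition fano_ideal (G : set {mpoly K[m]}) : set {mpoly K[plucker_dim]} :=
  [set h | stiefel_ideal G (h \mPo plucker generic_mx)].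

Definition fano (G : set {mpoly K[m]}) : set (projPoint K plucker_dim) :=
  zeros (fano_ideal G).

(* p is the K-rational point of G(k, m) given by the row space of U, which is
   required to be of dimension k: its ideal is generated by the forms vanishing
   at the Plucker coordinates of a basis of that space. *)
Definition is_point_of (U : 'M[K]_m) (p : projPoint K plucker_dim) :=
  exists A : 'M[K]_(k, m), [/\ row_free A, (A == U)%MS
    & pt_ideal p = [set h | forall d,
        (pihomog mdeg d h).@[tnth (plucker A)] = 0]].

End Grassmannian.

Arguments plucker_ideal K k m : clear implicits.
Arguments grassmannian K k m : clear implicits.
Arguments stiefel_ideal {K} k {m} G.
Arguments fano_ideal {K} k {m} G.
Arguments fano {K} k {m} G.
Arguments is_point_of {K} k {m} U p.

Definition perfect_matchings (m : nat) : {set {set {set 'I_m}}} :=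
  [set P : {set {set 'I_m}} |
    finset.partition P [set: 'I_m] & [forall B in P, #|B| == 2%N]]%SET.

Definition indicator_col (K : fieldType) (m : nat) (B : {set 'I_m}) : 'cV[K]_m :=
  \col_j (j \in B)%:R.

(* The row vectors v with v_a + v_b = 0 for every {a, b} in P. *)
Definition matching_space (K : fieldType) (m : nat) (P : {set {set 'I_m}}) :
    'M[K]_m :=
  (\bigcap_(B in P) kermx (indicator_col K B))%MS.

Fixpoint double_fact (n : nat) : nat :=
  if n is p.+2 then (n * double_fact p)%N else 1%N.

(* Main.v *)
Require Import Defs.
From HB Require Import structures.
From mathcomp Require Import all_boot all_order all_algebra.
From mathcomp Require Import boolp classical_sets functions cardinality reals.
From mathcomp Require Import topology mpoly.
From mathcomp Require Import perm ring_quotient generic_quotient fraction.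
From mathcomp Require Import ring zify.

(** A homogeneous prime of the Plucker coordinate ring that contains the Fano
ideal is the kernel of evaluation at the maximal minors of an [n] x [m] matrix
[X] over a field extension, of rank [n], such that the given forms vanish on the
row space of [X]; conversely every such matrix gives a point of the Fano scheme.

Let [l_1, .., l_m] be the columns of [X], viewed as linear forms on the row
space. The equation [e_(m-1) = 0] reads [sum_j prod_(i != j) l_i = 0]. On the
hyperplane [l_a = 0] only the summand [j = a] is left, so some [l_b], [b != a],
is a multiple of [l_a]. If [l_a = 0] then also [l_b = 0], and the point lies in
a coordinate component. If all [l_j] are nonzero, the classes of proportional
columns have at least two elements, and there are at least [n] of them since [X]
has rank [n]; hence they form a perfect matching, and the equation forces
[l_a + l_b = 0] on each pair. Nonvanishing of the minors with one column in each
pair of a given matching is an open condition that singles out its point, so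
these points are isolated. A coordinate component is the closure of the point of
the generic matrix with two zero columns; an irreducible closed subset that
contains it and lies in the Fano scheme avoids the isolated points, hence is
covered by the coordinate components, and the other ones miss the generic
point. *)

Set Implicit Arguments.
Unset Strict Implicit.
Unset Printing Implicit Defensive.

Import GRing.Theory.
Local Open Scope classical_set_scope.
Local Open Scope ring_scope.

(** * Evaluation of multivariate polynomials *)

Section Evaluation.

Lemma rmorph_mmap n (R S T : nzRingType) (g : {rmorphism S -> T}) (f : R -> S)
    (h : 'I_n -> S) (p : {mpoly R[n]}) :
  g (mmap f h p) = mmap (g \o f) (g \o h) p.
Proof.
rewrite /mmap rmorph_sum; apply: eq_bigr => m _.
rewrite rmorphM; congr (_ * _); rewrite /mmap1 rmorph_prod.
by apply: eq_bigr => i _; rewrite rmorphXn.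
Qed.

Lemma eq_mmap n (R S : nzRingType) (f f' : R -> S) (h h' : 'I_n -> S) p :
  f =1 f' -> h =1 h' -> mmap f h p = mmap f' h' p.
Proof.
by move=> ff hh; apply: eq_bigr => m _; rewrite ff (mmap1_eq _ hh).
Qed.

Lemma mmap_mPo n k (R : nzRingType) (S : comNzRingType) (f : {rmorphism R -> S})
    (h : 'I_k -> S) (lq : n.-tuple {mpoly R[k]}) p :
  mmap f h (p \mPo lq) = mmap f (fun j => mmap f h (tnth lq j)) p.
Proof.
rewrite /comp_mpoly (rmorph_mmap (mmap f h)).
by apply: eq_mmap => // c /=; rewrite mmapC.
Qed.

Lemma mmap_map_mpoly n (R S : nzRingType) (T : comNzRingType)
    (i : {rmorphism S -> T}) (f : {rmorphism R -> S}) (h : 'I_n -> T) p :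
  mmap i h (map_mpoly f p) = mmap (i \o f) h p.
Proof.
rewrite /map_mpoly (rmorph_mmap (mmap i h)).
by apply: eq_mmap => c /=; rewrite ?mmapC // mmapX mmap1U.
Qed.

Lemma mmap_scale n d (R : nzRingType) (S : comNzRingType) (f : {rmorphism R -> S})
    c (y : 'I_n -> S) p : p \is d.-homog ->
  mmap f (fun j => c * y j) p = c ^+ d * mmap f y p.
Proof.
move=> /dhomogP hp; rewrite /mmap mulr_sumr big_seq [RHS]big_seq.
apply: eq_bigr => m mp; rewrite mulrCA; congr (_ * _).
have <- : mdeg m = d := hp _ mp.
rewrite /mmap1 mdegE -prodrXr -big_split /=.
by apply: eq_bigr => i _; rewrite exprMn.
Qed.

(** The substitution [X_b := y_b T] multiplies a monomial of degree [e] by [T^e], so the powers of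
    [T] keep the homogeneous components apart. *)
Lemma coef_mmap_scaleX n d (R : nzRingType) (S : comNzRingType)
    (f : {rmorphism R -> S}) (y : 'I_n -> S) h :
  (mmap (@polyC S \o f) (fun b => 'X * (y b)%:P) h)`_d =
  mmap f y (pihomog mdeg d h).
Proof.
rewrite pihomogE coef_sum (raddf_sum (mmap f y)) /=.
rewrite [RHS]big_mkcond /=; apply: eq_bigr => m _.
rewrite mmapZ mmapX /mmap1.
have -> : \prod_(i < n) ('X * (y i)%:P) ^+ m i =
    (\prod_(i < n) y i ^+ m i)%:P * 'X^(mdeg m).
  rewrite mdegE -prodrXr rmorph_prod -big_split; apply: eq_bigr => i _ /=.
  by rewrite exprMn rmorphXn mulrC.
by rewrite mulrA /= -polyCM coefCM coefXn eq_sym; case: eqP; rewrite ?mulr1 ?mulr0.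
Qed.

Lemma mmap_scaleX_eq0 n (R : nzRingType) (S : comNzRingType)
    (f : {rmorphism R -> S}) (y : 'I_n -> S) h :
  mmap (@polyC S \o f) (fun b => 'X * (y b)%:P) h = 0 <->
  forall d, mmap f y (pihomog mdeg d h) = 0.
Proof.
split=> [h0 d|h0]; first by rewrite -coef_mmap_scaleX h0 coef0.
by apply/polyP => d; rewrite coef_mmap_scaleX h0 coef0.
Qed.

End Evaluation.

(** * Points of projective space *)

Section FractionField.
Variables (D : comNzRingType).
Hypothesis D_integral : GRing.integral_domain_axiom D.

(** The fraction field is built over an [idomainType], which carries a boolean unit predicate and an
    inverse function. Both are chosen classically here, the inverse being the identity off the
    units. *)
Definition invertible (x : D) := `[< exists y, y * x = 1 >].
Definition some_inverse (x : D) : D :=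
  if pselect (exists y, y * x = 1) is left e then sval (cid e) else x.

Lemma some_inverseVx : {in invertible, left_inverse 1 some_inverse *%R}.
Proof.
move=> x /asboolP ex; rewrite /some_inverse; case: pselect => // e.
exact: svalP (cid e).
Qed.

Lemma invertibleP (x y : D) : y * x = 1 -> invertible x.
Proof. by move=> yx; apply/asboolP; exists y. Qed.

Lemma some_inverse_out : {in [predC invertible], some_inverse =1 id}.
Proof.
move=> x /asboolPn nex; rewrite /some_inverse; case: pselect => // e.
Qed.

Lemma domain_into_field :
  exists (L : fieldType) (f : {rmorphism D -> L}), forall x, f x = 0 -> x = 0.
Proof.
pose mU := GRing.ComNzRing_hasMulInverse.Build D
  some_inverseVx invertibleP some_inverse_out.
pose DU : comUnitRingType := HB.pack D mU.
pose mI := GRing.ComUnitRing_isIntegral.Build DU D_integral.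
pose DI : idomainType := HB.pack D mU mI.
exists {fraction DI}, (@FracField.tofrac DI : {rmorphism DI -> {fraction DI}}).
by move=> x /eqP; rewrite tofrac_eq0 => /eqP.
Qed.

End FractionField.

Section ProjectivePoints.
Variables (K : fieldType) (N : nat).
Implicit Types (p q : projPoint K N) (g h : {mpoly K[N]}).

Lemma pt_ideal0 p : pt_ideal p 0.
Proof. by case: p. Qed.

Lemma pt_idealD p g h : pt_ideal p g -> pt_ideal p h -> pt_ideal p (g + h).
Proof. by case: p => I a1 a2 a3 a4 a5 a6; apply: a2. Qed.

Lemma pt_idealMl p g h : pt_ideal p h -> pt_ideal p (g * h).
Proof. by case: p => I a1 a2 a3 a4 a5 a6; apply: a3. Qed.

Lemma pt_ideal_prime p g h : pt_ideal p (g * h) -> pt_ideal p g \/ pt_ideal p h.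
Proof. by case: p => I a1 a2 a3 a4 a5 a6; apply: a4. Qed.

Lemma pt_ideal_pihomog p h d : pt_ideal p h -> pt_ideal p (pihomog mdeg d h).
Proof. by case: p => I a1 a2 a3 a4 a5 a6; apply: a5. Qed.

Lemma pt_ideal_relevant p : exists i : 'I_N, ~ pt_ideal p 'X_i.
Proof. by case: p. Qed.

Lemma pt_idealMr p g h : pt_ideal p g -> pt_ideal p (g * h).
Proof. by rewrite mulrC; apply: pt_idealMl. Qed.

Lemma pt_idealB p g h : pt_ideal p g -> pt_ideal p h -> pt_ideal p (g - h).
Proof.
by move=> pg ph; apply: pt_idealD => //; rewrite -mulN1r; apply: pt_idealMl.
Qed.

Lemma pt_ideal1 p : ~ pt_ideal p 1.
Proof.
have [i pi] := pt_ideal_relevant p => p1; apply: pi.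
by rewrite -[X in pt_ideal p X]mulr1; apply: pt_idealMl.
Qed.

Lemma pt_ideal_sum p (J : Type) (r : seq J) (P : pred J) (F : J -> {mpoly K[N]}) :
  (forall j, P j -> pt_ideal p (F j)) -> pt_ideal p (\sum_(j <- r | P j) F j).
Proof.
by move=> pF; elim/big_ind: _ => //; [apply: pt_ideal0|apply: pt_idealD].
Qed.

Lemma pt_ideal_prod p (J : finType) (P : pred J) (F : J -> {mpoly K[N]}) :
  (forall j, P j -> ~ pt_ideal p (F j)) <-> ~ pt_ideal p (\prod_(j | P j) F j).
Proof.
split=> [npF|npF j Pj pF].
  elim/big_ind: _ => //; first exact: pt_ideal1.
  by move=> g h ng nh /pt_ideal_prime[].
by apply: npF; rewrite (bigD1 j) //=; apply: pt_idealMr.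
Qed.

Lemma pt_ideal_inj p q : pt_ideal p = pt_ideal q -> p = q.
Proof.
case: p q => I a1 a2 a3 a4 a5 a6 [J b1 b2 b3 b4 b5 b6] /= IJ; subst J.
by congr ProjPoint; apply: Prop_irrelevance.
Qed.

Lemma pt_ideal_homogP p h :
  pt_ideal p h <-> forall d, pt_ideal p (pihomog mdeg d h).
Proof.
split=> [ph d|ph]; first exact: pt_ideal_pihomog.
rewrite [X in pt_ideal p X](pihomog_partitionE (mf := mdeg) (leqnn (msize h))).
exact: pt_ideal_sum.
Qed.

(** Points need not be rational, so coordinates are allowed in any commutative [K]-algebra. The form
    [h] is tested component by component because only homogeneous vanishing is invariant under
    rescaling. *)
Definition has_coordinates p (L : comNzRingType) (f : {rmorphism K -> L})
    (y : 'I_N -> L) :=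
  forall h, pt_ideal p h <-> forall d, mmap f y (pihomog mdeg d h) = 0.

Lemma has_coordinates_uniq p q (L : comNzRingType) (f : {rmorphism K -> L}) y :
  has_coordinates p f y -> has_coordinates q f y -> p = q.
Proof.
move=> py qy; apply: pt_ideal_inj.
by rewrite eqEsubset; split=> h; [rewrite py qy|rewrite qy py].
Qed.

Lemma has_coordinates_homog p (L : comNzRingType) (f : {rmorphism K -> L}) y d h :
  has_coordinates p f y -> h \is d.-homog -> pt_ideal p h <-> mmap f y h = 0.
Proof.
move=> py hd; rewrite py; split=> [/(_ d)|h0 e]; first by rewrite pihomog_dE.
have [->|de] := eqVneq e d; first by rewrite pihomog_dE.
by rewrite (pihomog_ne0 (d := d)) 1?eq_sym // raddf0.
Qed.

Lemma has_coordinatesZ p (L : idomainType) (f : {rmorphism K -> L})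
    (c : L) (y y' : 'I_N -> L) :
  c != 0 -> (forall j, y' j = c * y j) ->
  has_coordinates p f y <-> has_coordinates p f y'.
Proof.
move=> c0 y'E.
have E h : (forall d, mmap f y (pihomog mdeg d h) = 0) <->
           (forall d, mmap f y' (pihomog mdeg d h) = 0).
  have yE d : mmap f y' (pihomog mdeg d h) = c ^+ d * mmap f y (pihomog mdeg d h).
    by rewrite (eq_mmap _ (frefl f) y'E) (mmap_scale _ _ _ (pihomogP _ _ _)).
  split=> h0 d; first by rewrite yE h0 mulr0.
  by apply/eqP; have /eqP := h0 d; rewrite yE mulf_eq0 expf_eq0 (negPf c0) andbF.
by split=> py h; rewrite py E.
Qed.

Lemma has_coordinates_neq0 p (L : comNzRingType) (f : {rmorphism K -> L}) y :
  has_coordinates p f y -> exists j, y j != 0.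
Proof.
move=> py; have [j npj] := pt_ideal_relevant p; exists j; apply/eqP => yj0.
apply: npj; apply/(has_coordinates_homog (d := 1) py).
  by rewrite dhomogX /= mdeg1.
by rewrite mmapX mmap1U.
Qed.

(* The point is the kernel of the substitution [X_j := y_j T] into [L[T]], a
   ring homomorphism to a domain that separates the homogeneous components. *)
Lemma point_with_coordinates (L : idomainType) (f : {rmorphism K -> L}) y :
  (exists j, y j != 0) -> exists p, has_coordinates p f y.
Proof.
move=> [j0 yj0]; pose phi : {rmorphism {mpoly K[N]} -> {poly L}} :=
  mmap (@polyC L \o f) (fun j => 'X * (y j)%:P).
have phi0 : phi 0 = 0 by rewrite raddf0.
have phiD g h : phi g = 0 -> phi h = 0 -> phi (g + h) = 0.
  by move=> g0 h0; rewrite raddfD /= g0 h0 addr0.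
have phiM g h : phi h = 0 -> phi (g * h) = 0.
  by move=> h0; rewrite /phi rmorphM /= -/phi h0 mulr0.
have phiP g h : phi (g * h) = 0 -> phi g = 0 \/ phi h = 0.
  by rewrite rmorphM /= => /eqP; rewrite mulf_eq0 => /orP[]/eqP; [left|right].
have phiH h d : phi h = 0 -> phi (pihomog mdeg d h) = 0.
  move=> /mmap_scaleX_eq0 h0; apply/mmap_scaleX_eq0 => e.
  have [->|de] := eqVneq e d; first by rewrite pihomog_id.
  by rewrite (pihomog_ne0 (d := d)) 1?eq_sym ?pihomogP // raddf0.
have phiX : exists i, phi 'X_i <> 0.
  exists j0; rewrite /phi /= mmapX mmap1U; apply/eqP.
  by rewrite mulf_neq0 ?polyX_eq0 // polyC_eq0.
exists (@ProjPoint K N [set h | phi h = 0] phi0 phiD phiM phiP phiH phiX) => h /=.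
exact: mmap_scaleX_eq0.
Qed.

(** * A field-valued point attached to each homogeneous prime *)

Section ResidueField.
Variable p : projPoint K N.

Definition pt_pred : {mpoly K[N]} -> bool := fun h => `[< pt_ideal p h >].

Lemma pt_pred_idealr : idealr_closed (pt_pred : {pred {mpoly K[N]}}).
Proof.
split; first exact/asboolP/pt_ideal0; first exact/asboolPn/pt_ideal1.
move=> a g h /asboolP pg /asboolP ph; apply/asboolP.
by apply: pt_idealD => //; apply: pt_idealMl.
Qed.

Lemma pt_pred_prime : prime_idealr_closed (pt_pred : {pred {mpoly K[N]}}).
Proof.
move=> g h /asboolP /pt_ideal_prime[] pgh; apply/orP; [left|right]; exact/asboolP.
Qed.

HB.instance Definition _ := isIdealr.Build {mpoly K[N]} pt_pred pt_pred_idealr.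
HB.instance Definition _ :=
  isPrimeIdealrClosed.Build {mpoly K[N]} pt_pred pt_pred_prime.

(** The quotient by the prime is a domain, the coordinate ring of the affine cone over the point,
    and embeds into a field. The images of the variables then serve as coordinates. *)
Lemma residue_field : exists (L : fieldType) (phi : {rmorphism {mpoly K[N]} -> L}),
  forall h, pt_ideal p h <-> phi h = 0.
Proof.
pose D : comNzRingType := {ideal_quot (pt_pred : prime_idealr {mpoly K[N]})}.
have [|L [psi psi0]] := @domain_into_field D.
  exact: Quotient.rquot_IdomainAxiom.
pose pi : {rmorphism {mpoly K[N]} -> D} := (\pi_D)%qT.
exists L, (psi \o pi : {rmorphism _ -> _}) => h /=.
have -> : pt_ideal p h <-> pi h = 0.
  rewrite -[0](rmorph0 pi); split=> [ph|/eqP].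
    by apply/eqP; rewrite /pi /= -Quotient.idealrBE subr0; apply/asboolP.
  by rewrite /pi /= -Quotient.idealrBE subr0 => /asboolP.
by split=> [->|/psi0 //]; rewrite rmorph0.
Qed.

End ResidueField.

Lemma residue_coordinates p (L : fieldType) (phi : {rmorphism {mpoly K[N]} -> L}) :
  (forall h, pt_ideal p h <-> phi h = 0) ->
  has_coordinates p (phi \o @mpolyC N K) (fun j => phi 'X_j).
Proof.
move=> pphi h; rewrite pt_ideal_homogP.
have E g : mmap (phi \o @mpolyC N K) (fun j => phi 'X_j) g = phi g.
  rewrite [in RHS](mpolyE g) rmorph_sum; apply: eq_bigr => m _.
  rewrite -mul_mpolyC rmorphM /mmap1 mpolyXE_id rmorph_prod /=.
  by congr (_ * _); apply: eq_bigr => i _; rewrite rmorphXn.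
by split=> h0 d; have := h0 d; rewrite E pphi.
Qed.

(** The linear forms [y a * 'X_b - y b * 'X_a] vanish at [p], hence at its specialization [q], whose
    coordinates are therefore a multiple of [y]. This makes rational points closed. *)
Lemma rational_point_max p q y :
  has_coordinates p idfun y -> pt_ideal p `<=` pt_ideal q -> q = p.
Proof.
move=> py pq; have [L [phi qphi]] := residue_field q.
have qy := residue_coordinates qphi.
pose f : {rmorphism K -> L} := phi \o @mpolyC N K.
have [a ya] := has_coordinates_neq0 py.
have rel b : f (y a) * phi 'X_b = f (y b) * phi 'X_a.
  apply/eqP; rewrite /f /= -subr_eq0 -!rmorphM -rmorphB; apply/eqP/qphi/pq.
  apply/(has_coordinates_homog (d := 1) py).
    by rewrite rpredB // mul_mpolyC dhomogZ // dhomogX /= mdeg1.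
  by rewrite rmorphB !rmorphM /= !mmapC !mmapX !mmap1U mulrC subrr.
have fa0 : f (y a) != 0 by rewrite fmorph_eq0.
have phia0 : phi 'X_a != 0.
  have [b /= phib] := has_coordinates_neq0 qy; apply/eqP => phia.
  by have /eqP := rel b; rewrite phia mulr0 mulf_eq0 (negPf fa0) (negPf phib).
have c0 : phi 'X_a / f (y a) != 0 by rewrite mulf_neq0 ?invr_neq0.
have qfy : has_coordinates q f (f \o y).
  apply/(has_coordinatesZ q f c0 _); last exact: qy.
  by move=> b /=; rewrite mulrAC [X in _ = X * _]mulrC -rel mulrC mulKf.
apply: pt_ideal_inj; rewrite eqEsubset; split=> h.
  rewrite qfy py => h0 d; apply/eqP; rewrite -(fmorph_eq0 f).
  by rewrite (rmorph_mmap f) /= (h0 d).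
exact: pq.
Qed.

End ProjectivePoints.

(** * Points of Fano schemes as matrices *)

Lemma enum_val_ltn m (S : {set 'I_m}) (i j : 'I_#|S|) :
  (i < j)%N -> (enum_val i < enum_val j)%N.
Proof.
move=> ij; have x0 : 'I_m := enum_val i.
have sS : sorted ltn [seq val x | x <- enum S].
  rewrite /enum_mem -enumT.
  apply: (subseq_sorted ltn_trans (s2 := map val (enum 'I_m))).
    by rewrite map_subseq // filter_subseq.
  by rewrite val_enum_ord iota_ltn_sorted.
have sz (l : 'I_#|S|) : (l < size (enum S))%N by rewrite -cardE.
have := sorted_ltn_nth ltn_trans 0 sS (i : nat) (j : nat).
rewrite !inE !size_map => /(_ (sz _) (sz _) ij).
by rewrite !(nth_map x0) // -!(enum_val_nth x0).
Qed.

Section MatrixCoordinates.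
Variables (k m : nat).
Local Notation N := (plucker_dim k m).

Lemma tnth_plucker (A : comNzRingType) (X : 'M[A]_(k, m)) a :
  tnth (plucker X) a = \det (colsub (enum_val a) X).
Proof. by rewrite tnth_mktuple. Qed.

Lemma colsub_mul (A : comNzRingType) k' r l (s : 'I_l -> 'I_r)
    (G : 'M[A]_(k', k)) (X : 'M[A]_(k, r)) : colsub s (G *m X) = G *m colsub s X.
Proof.
by apply/matrixP => i j; rewrite !mxE; apply: eq_bigr => u _; rewrite !mxE.
Qed.

Lemma map_colsub (A B : comNzRingType) (g : A -> B) l
    (s : 'I_l -> 'I_m) (X : 'M[A]_(k, m)) :
  colsub s (map_mx g X) = map_mx g (colsub s X).
Proof. by apply/matrixP => i j; rewrite !mxE. Qed.

Lemma plucker_map (A B : comNzRingType) (g : {rmorphism A -> B})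
    (X : 'M[A]_(k, m)) a :
  tnth (plucker (map_mx g X)) a = g (tnth (plucker X) a).
Proof. by rewrite !tnth_plucker map_colsub det_map_mx. Qed.

Lemma plucker_mul (A : comNzRingType) (G : 'M[A]_k) (X : 'M[A]_(k, m)) a :
  tnth (plucker (G *m X)) a = \det G * tnth (plucker X) a.
Proof. by rewrite !tnth_plucker colsub_mul det_mulmx. Qed.

Lemma sort_selection (s : 'I_k -> 'I_m) : injective s ->
  exists (a : 'I_N) (sigma : 'S_k), forall i, s i = enum_val a (sigma i).
Proof.
move=> s_inj; pose S := [set s i | i : 'I_k]%SET.
have cS : #|S| = k by rewrite card_imset // card_ord.
have Ss i : s i \in S by apply: imset_f.
pose t : {ffun 'I_k -> 'I_m} := [ffun i => enum_val (cast_ord (esym cS) i)].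
have t_idx : t \in plucker_idx k m.
  rewrite inE; apply/'forall_forallP => i j; apply/implyP => ij; rewrite !ffunE.
  exact: enum_val_ltn.
pose r i := cast_ord cS (enum_rank_in (Ss i) (s i)).
have tr i : t (r i) = s i by rewrite ffunE cast_ordK enum_rankK_in.
have r_inj : injective r.
  by move=> i j rij; apply: s_inj; rewrite -(tr i) -(tr j) rij.
exists (enum_rank_in t_idx t), (perm r_inj) => i.
by rewrite enum_rankK_in // permE tr.
Qed.

Lemma det_colsub_perm (A : comNzRingType) (X : 'M[A]_(k, m)) (s t : 'I_k -> 'I_m)
    (sigma : 'S_k) : (forall i, s i = t (sigma i)) ->
  \det (colsub s X) = (-1) ^+ sigma * \det (colsub t X).
Proof.
move=> st; have -> : colsub s X = col_perm sigma (colsub t X).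
  by apply/matrixP => i j; rewrite !mxE st.
by rewrite col_permE det_mulmx det_perm odd_permV mulrC.
Qed.

Lemma det_colsub_eq0 (A : comNzRingType) (X : 'M[A]_(k, m)) (s : 'I_k -> 'I_m) :
  ~ injective s -> \det (colsub s X) = 0.
Proof.
move=> /injectiveP/injectivePn[i [j ij sij]].
rewrite -det_tr; apply: (determinant_alternate ij) => r.
by rewrite !mxE sij.
Qed.

Variable K : fieldType.

(* The minor on an arbitrary selection of columns, as a polynomial in the
   Plucker coordinates, which are only indexed by increasing selections. *)
Definition minor_poly (s : 'I_k -> 'I_m) : {mpoly K[N]} :=
  if [pick u : 'I_N * 'S_k | [forall i, s i == enum_val u.1 (u.2 i)]] is Some u
  then (-1) ^+ u.2 *: 'X_u.1 else 0.

Lemma minor_poly_homog s : minor_poly s \is 1.-homog.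
Proof.
rewrite /minor_poly; case: pickP => [u _|_]; last exact: dhomog0.
by rewrite dhomogZ // dhomogX /= mdeg1.
Qed.

Lemma minor_polyE (A : comNzRingType) (f : {rmorphism K -> A}) (X : 'M[A]_(k, m)) s :
  mmap f (tnth (plucker X)) (minor_poly s) = \det (colsub s X).
Proof.
rewrite /minor_poly; case: pickP => [[a sigma] /= /forallP sE|noS].
  rewrite mmapZ mmapX mmap1U tnth_plucker rmorphXn rmorphN1.
  by rewrite (det_colsub_perm (t := enum_val a) X (fun i => eqP (sE i))).
rewrite raddf0 det_colsub_eq0 // => /sort_selection[a [sigma sE]].
by have /forallP[] := noS (a, sigma); move=> i; apply/eqP.
Qed.

(** The substitution of [generic_restriction] for a matrix over an arbitrary [K]-algebra: the form
    [g] on the row space, in the parameters given by the rows. *)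
Definition restriction (A : comNzRingType) (f : {rmorphism K -> A})
    (X : 'M[A]_(k, m)) (g : {mpoly K[m]}) : {mpoly A[k]} :=
  mmap (@mpolyC k A \o f) (fun j => \sum_i (X i j)%:MP * 'X_i) g.

Lemma eq_restriction (A : comNzRingType) (f f' : {rmorphism K -> A}) X :
  f =1 f' -> restriction f X =1 restriction f' X.
Proof. by move=> ff g; apply: eq_mmap => // c /=; rewrite ff. Qed.

Lemma generic_restrictionE (g : {mpoly K[m]}) :
  generic_restriction k g = restriction (@mpolyC (k * m) K) (generic_mx K k m) g.
Proof.
rewrite /generic_restriction /comp_mpoly mmap_map_mpoly.
by apply: eq_mmap => // j; rewrite tnth_mktuple.
Qed.

Lemma map_restriction (A B : comNzRingType) (f : {rmorphism K -> A})
    (h : {rmorphism A -> B}) X g :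
  map_mpoly h (restriction f X g) = restriction (h \o f) (map_mx h X) g.
Proof.
rewrite /restriction (rmorph_mmap (map_mpoly h)); apply: eq_mmap => [c|j] /=.
  by rewrite map_mpolyC.
rewrite rmorph_sum; apply: eq_bigr => i _ /=.
by rewrite rmorphM /= map_mpolyC map_mpolyX mxE.
Qed.

(** Associativity [t (G X) = (t G) X]: a change of rows is a linear substitution in the
    parameters. *)
Lemma restriction_mul (A : comNzRingType) (f : {rmorphism K -> A}) (G : 'M[A]_k) X g :
  restriction f (G *m X) g =
  restriction f X g \mPo [tuple \sum_l (G l i)%:MP * 'X_l | i < k].
Proof.
rewrite /restriction [in RHS](rmorph_mmap (comp_mpoly _)).
apply: eq_mmap => [c|j] /=; first by rewrite comp_mpolyC.
rewrite rmorph_sum /=.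
under [RHS]eq_bigr => i _ do
  rewrite rmorphM /= comp_mpolyC comp_mpolyXU -tnth_nth tnth_mktuple mulr_sumr.
rewrite exchange_big; apply: eq_bigr => l _ /=.
rewrite mxE rmorph_sum mulr_suml; apply: eq_bigr => i _.
by rewrite rmorphM /= mulrCA mulrA.
Qed.

Lemma restriction_mul_eq0 (A : comNzRingType) (f : {rmorphism K -> A})
    (G : 'M[A]_k) X g :
  restriction f X g = 0 -> restriction f (G *m X) g = 0.
Proof. by rewrite restriction_mul => ->; rewrite raddf0. Qed.

Lemma map_generic_mx (A : comNzRingType) (f : {rmorphism K -> A}) (X : 'M[A]_(k, m)) :
  map_mx (mmap f (mxvec X 0)) (generic_mx K k m) = X.
Proof. by apply/matrixP => i j; rewrite !mxE mmapX mmap1U mxvecE. Qed.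

Lemma mmap_plucker_generic (A : comNzRingType) (f : {rmorphism K -> A})
    (X : 'M[A]_(k, m)) h :
  mmap f (mxvec X 0) (h \mPo plucker (generic_mx K k m)) =
  mmap f (tnth (plucker X)) h.
Proof.
rewrite mmap_mPo; apply: eq_mmap => // a.
by rewrite -(plucker_map (mmap f (mxvec X 0))) map_generic_mx.
Qed.

Variable G : set {mpoly K[m]}.

(** Specializing the generic entries to those of [X] sends the generators of the Stiefel ideal to
    the coefficients of the forms restricted to the row space of [X]. *)
Lemma stiefel_ideal_eval (A : comNzRingType) (f : {rmorphism K -> A})
    (X : 'M[A]_(k, m)) c : (forall g, G g -> restriction f X g = 0) ->
  stiefel_ideal k G c -> mmap f (mxvec X 0) c = 0.
Proof.
move=> GX [s sG ->]; rewrite rmorph_sum big_seq big1 // => u /sG[g Gg [a ->]] /=.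
rewrite rmorphM generic_restrictionE -mcoeff_map_mpoly map_restriction.
rewrite map_generic_mx (@eq_restriction _ _ f) ?GX ?mcoeff0 ?mulr0 //.
by move=> x /=; rewrite mmapC.
Qed.

(* Multiplying one row of [X] by [T] multiplies all maximal minors by [T], so
   that evaluation at this matrix separates the homogeneous components. *)
Lemma fano_of_coordinates p (L : idomainType) (f : {rmorphism K -> L})
    (X : 'M[L]_(k, m)) : (0 < k)%N -> has_coordinates p f (tnth (plucker X)) ->
  (forall g, G g -> restriction f X g = 0) -> fano k G p.
Proof.
move=> k0 pX GX h Gh; apply/pX/mmap_scaleX_eq0.
pose fL : {rmorphism K -> {poly L}} := @polyC L \o f.
pose D : 'M[{poly L}]_k :=
  diag_mx (\row_i if i == Ordinal k0 then 'X else 1).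
have detD : \det D = 'X.
  rewrite det_diag (bigD1 (Ordinal k0)) //= mxE eqxx big1 ?mulr1 // => i ni.
  by rewrite mxE (negPf ni).
have GDX g : G g -> restriction fL (D *m map_mx (@polyC L) X) g = 0.
  move=> Gg; apply: restriction_mul_eq0.
  by rewrite -(map_restriction f (@polyC L)) GX ?raddf0.
have := stiefel_ideal_eval GDX Gh; rewrite mmap_plucker_generic => E; rewrite -[RHS]E.
by apply: eq_mmap => // b; rewrite plucker_mul detD plucker_map.
Qed.

(** Substituting polynomials for the parameters replaces each coefficient by a linear combination of
    the old ones. *)
Lemma ideal_span_mcoeff (A : comNzRingType) l (q : {mpoly A[k]})
    (w : k.-tuple {mpoly A[l]}) a (J : set A) :
  (forall b, J q@_b) -> ideal_span J ((q \mPo w)@_a).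
Proof.
move=> Jq.
exists [seq ((\prod_(i < k) tnth w i ^+ b i)@_a, q@_b) | b : 'X_{1..k} <- msupp q].
  by move=> u /mapP[b _ ->] /=.
rewrite comp_mpolyE raddf_sum [RHS]big_map; apply: eq_bigr => b _ /=.
by rewrite mcoeffZ mulrC.
Qed.

(** Cramer's rule: in the expansion along the replaced column, the cofactors are those of the
    original selection, which the adjugate collects. *)
Lemma det_replace_col (A : comNzRingType) (X : 'M[A]_(k, m)) (s : 'I_k -> 'I_m) i j :
  \det (colsub (fun l => if l == i then j else s l) X) =
  (\adj (colsub s X) *m X) i j.
Proof.
set B := colsub _ X; rewrite (expand_det_col B i) mxE; apply: eq_bigr => l _.
rewrite mxE [RHS]mulrC /B !mxE eqxx; congr (_ * (_ * \det _)).
by apply/matrixP => u v; rewrite !mxE eq_sym (negPf (neq_lift _ _)).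
Qed.

(* In a chart [X_a0 != 0], given by the columns [s0], the matrix has as entry
   [(i, j)] the Plucker coordinate obtained from [s0] by replacing its [i]-th
   column by [j]: over the generic matrix [Z] it is [\adj Z_s0 *m Z]. *)
Lemma fano_coordinates p : fano k G p ->
  exists (L : fieldType) (f : {rmorphism K -> L}) (X : 'M[L]_(k, m)),
    has_coordinates p f (tnth (plucker X)) /\
    forall g, G g -> restriction f X g = 0.
Proof.
move=> Gp; have [L [phi pphi]] := residue_field p.
pose Z := generic_mx K k m.
pose ev : {rmorphism {mpoly K[N]} -> {mpoly K[k * m]}} := comp_mpoly (plucker Z).
have phi0 h : stiefel_ideal k G (ev h) -> phi h = 0.
  by move=> Gh; apply/pphi/Gp.
(* Zero lies in the Stiefel ideal as an empty combination, so every identity between minors of the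
   generic matrix persists at the point. *)
have phi_eq h h' : ev h = ev h' -> phi h = phi h'.
  move=> hh; apply/eqP; rewrite -subr_eq0 -rmorphB; apply/eqP/phi0.
  exists [::] => //; rewrite big_nil rmorphB.
  by apply/eqP; rewrite subr_eq0; apply/eqP.
have [a0 /pphi/eqP Xa0] := pt_ideal_relevant p.
pose s0 : 'I_k -> 'I_m := enum_val a0.
pose M : 'M[{mpoly K[N]}]_(k, m) :=
  \matrix_(i, j) minor_poly (fun l => if l == i then j else s0 l).
have evM : map_mx ev M = \adj (colsub s0 Z) *m Z.
  apply/matrixP => i j; rewrite -det_replace_col !mxE /ev /= /comp_mpoly.
  exact: (minor_polyE (@mpolyC _ K)).
have evX a : ev 'X_a = \det (colsub (enum_val a) Z).
  by rewrite /ev /= comp_mpolyXU -tnth_nth tnth_plucker.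
have evdet (s : 'I_k -> 'I_m) : ev (\det (colsub s M)) =
    \det (\adj (colsub s0 Z)) * \det (colsub s Z).
  by rewrite -det_map_mx -map_colsub evM colsub_mul det_mulmx.
have phiM0 : map_mx phi (colsub s0 M) = (phi 'X_a0)%:M.
  have evM0 : map_mx ev (colsub s0 M) = (ev 'X_a0)%:M.
    by rewrite -map_colsub evM colsub_mul mul_adj_mx evX.
  apply/matrixP => i j; have /matrixP/(_ i j) := evM0.
  by rewrite ![map_mx _ (colsub _ _) _ _]mxE ![_%:M _ _]mxE -!rmorphMn; apply: phi_eq.
(* The determinant of the adjugate is the power [k - 1] of the pivot minor; the quotient form also
   covers [k = 0]. *)
pose c := phi 'X_a0 ^+ k / phi 'X_a0.
have c0 : c != 0 by rewrite mulf_neq0 ?expf_neq0 ?invr_neq0.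
have plM a : tnth (plucker (map_mx phi M)) a = c * phi 'X_a.
  rewrite tnth_plucker map_colsub det_map_mx /c mulrAC; apply/esym.
  apply: (mulIf Xa0); rewrite mulfVK // mulrC -(det_scalar k) -phiM0 det_map_mx.
  rewrite -!rmorphM; apply: phi_eq; rewrite !rmorphM /= !evdet !evX /s0; ring.
exists L, (phi \o @mpolyC N K : {rmorphism K -> L}), (map_mx phi M); split.
  apply/(has_coordinatesZ p _ c0 plM).
  exact: residue_coordinates.
move=> g Gg; rewrite -map_restriction; apply/mpolyP => a.
rewrite mcoeff_map_mpoly mcoeff0; apply: phi0.
(* After pulling back to the generic matrix, [M] becomes a left multiple of it, so the coefficients
   are combinations of Stiefel generators. *)
rewrite -mcoeff_map_mpoly map_restriction evM restriction_mul.
apply: ideal_span_mcoeff => b; exists g; first exact: Gg.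
exists b; rewrite generic_restrictionE (@eq_restriction _ _ (@mpolyC (k * m) K)) //.
by move=> x; apply: comp_mpolyC.
Qed.

End MatrixCoordinates.

(** * The elementary symmetric polynomial of degree m - 1 *)

Section ElementarySymmetric.
Variables (m : nat) (K : fieldType).
Hypothesis m_gt0 : (0 < m)%N.

Lemma mmap_mesym_pred (A : comNzRingType) (f : {rmorphism K -> A}) (x : 'I_m -> A) :
  mmap f x (mesym m K m.-1) = \sum_j \prod_(l | l != j) x l.
Proof.
have setC1_inj : injective (fun j : 'I_m => [set~ j]%SET).
  by move=> i j /(congr1 (@finset.setC _)); rewrite !finset.setCK => /finset.set1_inj.
rewrite /mesym rmorph_sum /=.
rewrite (eq_bigl (fun h => h \in [set [set~ j]%SET | j : 'I_m]%SET)); last first.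
  move=> h; apply/eqP/imsetP => [hm|[j _ ->]].
    have /cards1P[j hj] : #|~: h|%SET == 1%N.
      by rewrite -(eqn_add2l #|h|) finset.cardsC card_ord hm addn1 prednK.
    by exists j => //; rewrite -hj finset.setCK.
  by rewrite cardsC1 card_ord.
rewrite big_imset /=; last by move=> i j _ _; apply: setC1_inj.
apply: eq_bigr => j _; rewrite rmorph_prod.
by apply: eq_big => [l|l _] /=; rewrite ?inE // mmapX mmap1U.
Qed.

(** Omitting one index leaves its partner times all the other pairs; the two omissions inside a pair
    add up to the sum of that pair. *)
Lemma sum_prod_pairs n (A : comNzRingType) (c : 'I_n * bool -> 'I_m) (x : 'I_m -> A) :
  bijective c ->
  \sum_j \prod_(l | l != j) x l =
  \sum_i (x (c (i, true)) + x (c (i, false))) *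
     \prod_(i' | i' != i) (x (c (i', true)) * x (c (i', false))).
Proof.
move=> c_bij; have c_inj := bij_inj c_bij.
rewrite (reindex c) /=; last exact: onW_bij.
rewrite (eq_bigr (fun u : 'I_n * bool => x (c (u.1, ~~ u.2)) *
    \prod_(i' | i' != u.1) (x (c (i', true)) * x (c (i', false))))).
  transitivity (\sum_i \sum_(e : bool) x (c (i, ~~ e)) *
      \prod_(i' | i' != i) (x (c (i', true)) * x (c (i', false)))).
    by rewrite pair_big.
  by apply: eq_bigr => i _; rewrite big_bool /= addrC mulrDl.
move=> [i e] _ /=; rewrite (reindex c) /=; last exact: onW_bij.
rewrite (eq_bigl (fun u : 'I_n * bool => u != (i, e))); last first.
  by move=> u; rewrite (inj_eq c_inj).
rewrite (bigD1 (i, ~~ e)) /=; last by rewrite xpair_eqE eqxx; case: (e).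
congr (_ * _).
transitivity (\prod_(i' | i' != i) \prod_(b : bool) x (c (i', b))).
  rewrite pair_big_dep /=; apply: eq_big => [[i' b]|[i' b] _] //=.
  rewrite andbT !xpair_eqE.
  by case: eqP => //= _; case: b (e) => -[].
by apply: eq_bigr => i' _; rewrite big_bool.
Qed.

Section Restriction.
Variables (k : nat) (L : comNzRingType) (f : {rmorphism K -> L}).
Implicit Type X : 'M[L]_(k, m).

Definition linear_form X j : {mpoly L[k]} := \sum_i (X i j)%:MP * 'X_i.

Lemma restriction_var X j : restriction f X 'X_j = linear_form X j.
Proof. by rewrite /restriction mmapX mmap1U. Qed.

Lemma linear_form_eq0 X j : linear_form X j = 0 <-> forall i, X i j = 0.
Proof.
split=> [l0 i|X0]; last first.
  by rewrite /linear_form big1 // => i _; rewrite X0 mul0r.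
have := congr1 (fun q : {mpoly L[k]} => q@_U_(i)) l0; rewrite mcoeff0 => <-.
rewrite raddf_sum (bigD1 i) //= mcoeffCM mcoeffX eqxx mulr1 big1 ?addr0 // => l li.
rewrite mcoeffCM mcoeffX [X in (nat_of_bool X)%:R](_ : _ = false) ?mulr0 //.
apply/negbTE/eqP => /mnmP/(_ i); rewrite !mnm1E eqxx (negPf li) //.
Qed.

Lemma restriction_mesym X :
  restriction f X (mesym m K m.-1) = \sum_j \prod_(l | l != j) linear_form X l.
Proof. exact: (mmap_mesym_pred (@mpolyC k L \o f)). Qed.

End Restriction.

(* On the hyperplane where the form [a] vanishes, only the summand omitting [a]
   survives, so one of its factors has to vanish on that hyperplane. *)
Lemma proportional_partner k (L : fieldType) (f : {rmorphism K -> L})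
    (X : 'M[L]_(k, m)) a : restriction f X (mesym m K m.-1) = 0 ->
  exists2 l, l != a & exists c, forall r, X r l = c * X r a.
Proof.
(* The rows of [W] span the hyperplane on which the form [a] vanishes, so [W *m X] restricts all the
   forms to it. *)
move=> X0; pose W : 'M[L]_k := (cokermx (col a X)^T)^T.
have WXE l r : (W *m X) r l = ((col l X)^T *m cokermx (col a X)^T) 0 r.
  by rewrite !mxE; apply: eq_bigr => i _; rewrite !mxE mulrC.
have := restriction_mul_eq0 W X0; rewrite restriction_mesym (bigD1 a) //=.
have WXa : linear_form (W *m X) a = 0.
  by apply/linear_form_eq0 => r; rewrite WXE mulmx_coker mxE.
rewrite [X in _ + X]big1 ?addr0 => [/eqP|j ja]; last first.
  by rewrite (bigD1 a) 1?eq_sym //= WXa mul0r.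
rewrite prodf_seq_eq0 => /hasP[l _ /andP[la /eqP/linear_form_eq0 WXl]].
exists l => //.
have /sub_rVP[c cE] : ((col l X)^T <= (col a X)^T)%MS.
  rewrite submxE; apply/eqP/rowP => r.
  by have := WXl r; rewrite WXE => ->; rewrite mxE.
by exists c => r; have /rowP/(_ r) := cE; rewrite !mxE.
Qed.

(** Normalizing the columns [c (i, true)] to the identity turns the equation into one in free values
    [v i], in which only the [i]-th summand is linear in [v i]. Comparing two values of [v] that
    differ by a sign isolates [2 (1 + gam i)] times a nonzero product. *)
Lemma paired_columns n (L : fieldType) (f : {rmorphism K -> L}) (X : 'M[L]_(n, m))
    (c : 'I_n * bool -> 'I_m) (gam : 'I_n -> L) :
  (2%:R != 0 :> L) -> bijective c -> restriction f X (mesym m K m.-1) = 0 ->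
  colsub (fun i => c (i, true)) X \in unitmx ->
  (forall r i, X r (c (i, false)) = gam i * X r (c (i, true))) ->
  (forall i, gam i != 0) -> forall i, gam i = -1.
Proof.
move=> two0 c_bij X0; set B := colsub _ X => uB XE gam0 i0.
have YE r i : (invmx B *m X) r (c (i, true)) = (r == i)%:R.
  have -> : (invmx B *m X) r (c (i, true)) = (invmx B *m B) r i.
    by rewrite !mxE; apply: eq_bigr => l _; rewrite !mxE.
  by rewrite mulVmx // mxE.
have YE' r i : (invmx B *m X) r (c (i, false)) = gam i * (r == i)%:R.
  rewrite -YE !mxE mulr_sumr; apply: eq_bigr => l _.
  by rewrite XE mulrCA.
have E v : \sum_i (1 + gam i) * v i * \prod_(i' | i' != i) (gam i' * v i' ^+ 2) = 0.
  have /(congr1 (mmap idfun v)) := restriction_mul_eq0 (invmx B) X0.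
  rewrite raddf0 restriction_mesym rmorph_sum /= => E; rewrite -[RHS]E {E}.
  pose x j := mmap idfun v (linear_form (invmx B *m X) j).
  rewrite [RHS](eq_bigr (fun j => \prod_(l | l != j) x l)); last first.
    by move=> j _; rewrite rmorph_prod.
  rewrite (sum_prod_pairs x c_bij).
  have xE j : x j = \sum_i (invmx B *m X) i j * v i.
    rewrite /x /linear_form rmorph_sum /=; apply: eq_bigr => i _ /=.
    by rewrite rmorphM /= mmapC mmapX mmap1U.
  have xt i : x (c (i, true)) = v i.
    rewrite xE (bigD1 i) //= YE eqxx mul1r big1 ?addr0 // => r ri.
    by rewrite YE (negPf ri) mul0r.
  have xf i : x (c (i, false)) = gam i * v i.
    rewrite xE (bigD1 i) //= YE' eqxx mulr1 big1 ?addr0 // => r ri.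
    by rewrite YE' (negPf ri) mulr0 mul0r.
  apply: eq_bigr => i _; rewrite xt xf mulrDl mul1r; congr (_ * _).
  by apply: eq_bigr => i' _; rewrite xt xf expr2 mulrCA.
pose P i := \prod_(i' | i' != i) gam i'.
(* The sign flip at [i0] is invisible to the other summands, which contain [v i0] only squared. *)
pose v i : L := if i == i0 then -1 else 1.
have v2 i : v i ^+ 2 = 1 by rewrite /v; case: ifP => _; rewrite ?sqrrN expr1n.
have := congr2 (fun u w => u - w) (E (fun=> 1)) (E v).
rewrite (bigD1 i0) //= [X in _ - X](bigD1 i0) //= {1}/v eqxx.
have prodE (w : 'I_n -> L) i : (forall i', w i' ^+ 2 = 1) ->
    \prod_(i' | i' != i) (gam i' * w i' ^+ 2) = P i.
  by move=> w2; apply: eq_bigr => i' _; rewrite w2 mulr1.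
have prod1 i : \prod_(i' | i' != i) (gam i' * 1 ^+ 2) = P i.
  by apply: (prodE (fun=> 1)) => i'; rewrite expr1n.
rewrite [X in _ + X - _](eq_bigr (fun i => (1 + gam i) * 1 * P i)); last first.
  by move=> i _; rewrite prod1.
rewrite [X in _ - (_ + X)](eq_bigr (fun i => (1 + gam i) * 1 * P i)); last first.
  by move=> i ii0; rewrite prodE // /v (negPf ii0).
rewrite prod1 prodE // subr0 => D0.
have : 2%:R * (1 + gam i0) * P i0 = 0 by rewrite -[RHS]D0; ring.
move/eqP; rewrite !mulf_eq0 (negPf two0) /= => /orP[|].
  by rewrite addrC addr_eq0 => /eqP.
by rewrite prodf_seq_eq0 => /hasP[i _]; rewrite (negPf (gam0 i)) andbF.
Qed.

End ElementarySymmetric.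

(** * Perfect matchings and column selections *)

Section Matchings.
Variables (n m : nat).
Hypothesis m2n : m = (2 * n)%N.

(** A numbering of the pairs of [P] and of the two indices in each, from which matrices and column
    selections can be written down. *)
Definition lists_pairs (c : 'I_n * bool -> 'I_m) (P : {set {set 'I_m}}) :=
  bijective c /\
  forall B, B \in P <-> exists i, B = [set c (i, true); c (i, false)]%SET.

Lemma card_matching P : P \in perfect_matchings m -> #|P| = n.
Proof.
rewrite inE => /andP[/card_partition + /forallP P2].
rewrite cardsT card_ord (eq_bigr (fun=> 2%N)) => [|B BP]; last first.
  by apply/eqP; move/implyP: (P2 B); apply.
rewrite sum_nat_const => mP; apply/eqP.
by rewrite -(eqn_pmul2r (isT : 0 < 2)%N) -mP [X in X == _]m2n mulnC.
Qed.

Lemma matching_pairs P : P \in perfect_matchings m -> exists c, lists_pairs c P.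
Proof.
move=> Pm; have cP := card_matching Pm.
move: Pm; rewrite inE => /andP[/and3P[/eqP Pcov /finset.trivIsetP Ptriv _] /forallP P2].
pose blk i : {set 'I_m} := enum_val (cast_ord (esym cP) i).
have blkP i : blk i \in P by apply: enum_valP.
have blk_inj : injective blk by move=> i j /enum_val_inj /cast_ord_inj.
have /choice[ab abE] i : exists u : 'I_m * 'I_m,
    u.1 != u.2 /\ blk i = [set u.1; u.2]%SET.
  have /implyP/(_ (blkP i)) := P2 (blk i).
  by move=> /cards2P[x [y [xy ->]]]; exists (x, y).
pose c (u : 'I_n * bool) := if u.2 then (ab u.1).1 else (ab u.1).2.
have c_blk u : c u \in blk u.1.
  by rewrite (abE u.1).2 /c !inE; case: u.2; rewrite eqxx ?orbT.
have c_inj : injective c.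
  move=> [i e] [j e'] cc; have ij : i = j.
    apply: contrapT => /eqP ij; have := Ptriv _ _ (blkP i) (blkP j).
    rewrite (inj_eq blk_inj) => /(_ ij) /disjointFr.
    by move=> /(_ _ (c_blk (i, e))); rewrite cc (c_blk (j, e')).
  subst j; congr (_, _); move: cc (abE i).1; rewrite /c /=.
  by case: e e' => -[] // ->; rewrite eqxx.
exists c; split.
  apply: inj_card_bij => //; rewrite card_prod card_bool !card_ord m2n.
  by rewrite mulnC.
move=> B; split=> [BP|[i ->]]; last by have := blkP i; rewrite (abE i).2.
exists (cast_ord cP (enum_rank_in BP B)).
by rewrite -[RHS](abE _).2 /blk cast_ordK enum_rankK_in.
Qed.

End Matchings.

(** * Vanishing minors and ranks of column selections *)

Section DetColumns.
Variables (k m : nat) (L : fieldType) (X : 'M[L]_(k, m)).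

Lemma det_proportional_cols (s : 'I_k -> 'I_m) i i' c : i != i' ->
  (forall r, X r (s i') = c * X r (s i)) -> \det (colsub s X) = 0.
Proof.
move=> ii' Xs; rewrite -det_tr; apply/eqP/det0P.
exists (delta_mx 0 i' - c *: delta_mx 0 i).
  apply/eqP => /rowP/(_ i'); rewrite !mxE !eqxx eq_sym (negPf ii') mulr0 subr0 /=.
  by apply/eqP; rewrite oner_eq0.
rewrite mulmxBl -scalemxAl -!rowE; apply/rowP => r.
by rewrite !mxE Xs subrr.
Qed.

Lemma det_zero_col (s : 'I_k -> 'I_m) i :
  (forall r, X r (s i) = 0) -> \det (colsub s X) = 0.
Proof.
by move=> X0; rewrite (expand_det_col _ i) big1 // => r _; rewrite mxE X0 mul0r.
Qed.

Lemma plucker_neq0_rank a : tnth (plucker X) a != 0 -> \rank X = k.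
Proof.
rewrite tnth_plucker => d0; apply/eqP; rewrite eqn_leq rank_leq_row /=.
have : colsub (enum_val a) X \in unitmx by rewrite unitmxE unitfE.
move/mxrank_unit => rk; rewrite -[X in (X <= _)%N]rk.
have -> : colsub (enum_val a) X = X *m colsub (enum_val a) 1%:M.
  by rewrite -colsub_mul mulmx1.
exact: mxrankM_maxl.
Qed.

Lemma det_colsub_neq0 (s : 'I_k -> 'I_m) : \det (colsub s X) != 0 ->
  exists a, tnth (plucker X) a != 0.
Proof.
move=> d0; have [/sort_selection[a [sigma sE]]|/(det_colsub_eq0 X)] :=
  pselect (injective s); last by move=> s0; rewrite s0 eqxx in d0.
exists a; apply: contraNneq d0; rewrite tnth_plucker => a0.
by rewrite (det_colsub_perm X sE) a0 mulr0.
Qed.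

Lemma spanning_selection l (s : 'I_l -> 'I_m) :
  (forall j, exists i c, forall r, X r j = c * X r (s i)) ->
  (\rank X <= \rank (colsub s X))%N.
Proof.
move=> sX; rewrite -mxrank_tr -[leqRHS]mxrank_tr; apply/mxrankS/row_subP => j.
have [i [c cE]] := sX j.
have -> : row j X^T = c *: row i (colsub s X)^T.
  by apply/rowP => r; rewrite !mxE cE.
exact/scalemx_sub/row_sub.
Qed.

End DetColumns.

(** * Matching points *)

Section MatchingPoints.
Variables (n m : nat) (K : fieldType).
Hypotheses (n_gt0 : (0 < n)%N) (m2n : m = (2 * n)%N) (two_neq0 : 2%:R != 0 :> K).
Local Notation N := (plucker_dim n m).
Local Notation F := (fano n [set mesym m K m.-1]).
Implicit Types (c : 'I_n * bool -> 'I_m) (p : projPoint K N).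

Let m_gt0 : (0 < m)%N. Proof. by rewrite m2n muln_gt0. Qed.

(** When [c] lists the pairs of a matching, the rows form a basis of its linear space. *)
Definition matching_mx c : 'M[K]_(n, m) :=
  \matrix_(i, j) ((j == c (i, true))%:R - (j == c (i, false))%:R).

(** One column from each pair. The minors on these selections are all nonzero at the matching point,
    and their nonvanishing singles it out. *)
Definition transversal c (e : 'I_n -> bool) : 'I_n -> 'I_m := fun i => c (i, e i).

Lemma matching_mxE c : injective c -> forall i u,
  matching_mx c i (c u) = if u.1 == i then (-1) ^+ (~~ u.2) else 0.
Proof.
move=> c_inj i [j e]; rewrite mxE !(inj_eq c_inj) !xpair_eqE /=.
by case: eqP => _; case: e; rewrite ?subr0 ?sub0r.
Qed.

Lemma matching_mx_transversal c (e : 'I_n -> bool) : injective c ->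
  \det (colsub (transversal c e) (matching_mx c)) != 0.
Proof.
move=> c_inj.
have -> : colsub (transversal c e) (matching_mx c) =
    diag_mx (\row_i (-1) ^+ (~~ e i)).
  apply/matrixP => i j; rewrite mxE (matching_mxE c_inj) /= !mxE eq_sym.
  by case: eqP => [->|].
rewrite det_diag prodf_seq_neq0; apply/allP => i _ /=.
by rewrite mxE signr_eq0.
Qed.

Lemma matching_mx_neq0 c : injective c ->
  exists a, tnth (plucker (matching_mx c)) a != 0.
Proof.
by move=> /(matching_mx_transversal (fun=> true)); apply: det_colsub_neq0.
Qed.

Lemma matching_mx_restriction c : bijective c ->
  restriction (idfun : {rmorphism K -> K}) (matching_mx c) (mesym m K m.-1) = 0.
Proof.
move=> c_bij; rewrite restriction_mesym // (sum_prod_pairs _ c_bij) big1 // => i _.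
rewrite [X in X * _](_ : _ = 0) ?mul0r //.
rewrite -big_split big1 //= => l _.
rewrite -mulrDl -mpolyCD !(matching_mxE (bij_inj c_bij)) /=.
by case: ifP => _; rewrite ?addr0 ?expr0 ?expr1 ?subrr mul0r.
Qed.

Lemma matching_point_mem c p : bijective c ->
  has_coordinates p idfun (tnth (plucker (matching_mx c))) -> F p.
Proof.
move=> c_bij pc; apply: (fano_of_coordinates n_gt0 pc) => _ ->.
exact: matching_mx_restriction.
Qed.

Lemma minor_poly_notin p (L : fieldType) (f : {rmorphism K -> L}) X s :
  has_coordinates p f (tnth (plucker X)) ->
  ~ pt_ideal p (minor_poly K s) <-> \det (colsub s X) != 0.
Proof.
move=> pX; rewrite (has_coordinates_homog pX (minor_poly_homog _ s)) minor_polyE.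
by split => [/eqP|/eqP].
Qed.

Lemma fmorph_coordinates p (L : fieldType) (f : {rmorphism K -> L}) (y : 'I_N -> K) :
  has_coordinates p idfun y <-> has_coordinates p f (f \o y).
Proof.
have E h d : mmap f (f \o y) (pihomog mdeg d h) = 0 <->
    mmap idfun y (pihomog mdeg d h) = 0.
  rewrite -(rmorph_mmap f) /=.
  by split=> [/eqP|->]; rewrite ?fmorph_eq0 ?rmorph0 // => /eqP.
by split=> py h; rewrite py; split=> h0 d; apply/E.
Qed.

(* A column is proportional to some other one, which has to be its partner in
   the matching since any other column shares a transversal with it. *)
Lemma matching_point_isolated c p : bijective c -> F p ->
  (forall e : 'I_n -> bool, ~ pt_ideal p (minor_poly K (transversal c e))) ->
  has_coordinates p idfun (tnth (plucker (matching_mx c))).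
Proof.
move=> c_bij /fano_coordinates[L [f [X [pX XF]]]] pc.
have c_inj := bij_inj c_bij; have := XF _ erefl => {XF} X0.
have detX e : \det (colsub (transversal c e) X) != 0 by apply/(minor_poly_notin _ pX).
have partner i : exists g, forall r, X r (c (i, false)) = g * X r (c (i, true)).
  have [l lc [g gE]] := proportional_partner m_gt0 (c (i, true)) X0.
  have [c' cK c'K] := c_bij; move: lc gE; rewrite -(c'K l); case: (c' l) => i' e'.
  rewrite (inj_eq c_inj) xpair_eqE; have [->|ii'] := eqVneq i' i.
    by case: e' => // _ gE; exists g.
  (* This choice makes the transversal pass through both proportional columns, so its minor would
     vanish. *)
  move=> _ gE; pose e := [eta (fun=> true) with i' |-> e'].
  have ei : e i = true by rewrite /e /= eq_sym (negPf ii').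
  have ei' : e i' = e' by rewrite /e /= eqxx.
  have := detX e; rewrite (det_proportional_cols (i := i) (i' := i') (c := g)) ?eqxx //.
    by rewrite eq_sym.
  by move=> r; rewrite /transversal ei ei'.
have [gam gamE] := choice partner.
have gam0 i : gam i != 0.
  apply/eqP => g0; have := detX (fun=> false).
  rewrite (det_zero_col (i := i)) ?eqxx // => r.
  by rewrite /transversal gamE g0 mul0r.
have uB : colsub (fun i => c (i, true)) X \in unitmx.
  by rewrite unitmxE unitfE; apply: (detX (fun=> true)).
have two0 : 2%:R != 0 :> L by rewrite -(rmorph_nat f) fmorph_eq0.
have gam1 := paired_columns m_gt0 two0 c_bij X0 uB (fun r i => gamE i r) gam0.
set B := colsub _ X in uB.
(* With all ratios equal to [-1], [X] has the row space of the matching matrix, and the Plucker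
   coordinates differ by the factor [\det B]. *)
have XB : X = B *m map_mx f (matching_mx c).
  have [c' cK c'K] := c_bij.
  have AE i u : map_mx f (matching_mx c) i (c u) =
      if u.1 == i then (-1) ^+ (~~ u.2) else 0.
    rewrite mxE (matching_mxE c_inj); case: eqP => _; last exact: rmorph0.
    by rewrite rmorphXn rmorphN1.
  apply/matrixP => r j; rewrite -(c'K j); case: (c' j) => i e.
  rewrite mxE (bigD1 i) //= big1 ?addr0 => [|l li]; last first.
    by rewrite AE eq_sym (negPf li) mulr0.
  rewrite AE /= eqxx mxE; case: e => /=; first by rewrite mulr1.
  by rewrite expr1 mulrN1 gamE gam1 mulN1r.
apply/(fmorph_coordinates p f).
have B0 : \det B != 0 by rewrite -unitfE -unitmxE.
apply/(has_coordinatesZ p f B0 _); last exact: pX.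
by move=> a; rewrite {1}XB plucker_mul plucker_map.
Qed.

(** A variable restricts to the corresponding column read as a linear form, which is zero exactly
    when the column is. *)
Lemma fano_vars (B : {set 'I_m}) p :
  (fano n [set f : {mpoly K[m]} | exists2 i, i \in B & f = 'X_i]) p <->
  exists (L : fieldType) (f : {rmorphism K -> L}) (X : 'M[L]_(n, m)),
    has_coordinates p f (tnth (plucker X)) /\
    forall j, j \in B -> forall r, X r j = 0.
Proof.
split=> [/fano_coordinates[L [f [X [pX XB]]]]|[L [f [X [pX XB]]]]].
  exists L, f, X; split=> // j jB; apply/linear_form_eq0.
  by rewrite -(restriction_var f); apply: XB; exists j.
apply: (fano_of_coordinates n_gt0 pX) => _ [j jB ->].
by rewrite restriction_var; apply/linear_form_eq0/XB.
Qed.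

Lemma same_block (T : finType) (r : rel T) (B : {set T}) x y :
  {in [set: T]%SET & &, equivalence_rel r} ->
  B \in equivalence_partition r [set: T]%SET -> x \in B -> y \in B -> r x y.
Proof.
move=> r_equiv /imsetP[z _ ->]; rewrite !inE /= => zx zy.
have inT u : u \in [set: T]%SET by rewrite finset.in_setT.
by have [_ /(_ zx) <-] := r_equiv z x y (inT _) (inT _) (inT _).
Qed.

(* Proportionality classes of columns have at least two members by
   [proportional_partner], and there are at least [n] of them because the matrix
   has rank [n]; as there are only [2n] columns, the classes form a matching. *)
Lemma fano_classification p : F p ->
  (exists2 B : {set 'I_m}, #|B| = 2%N &
     fano n [set f : {mpoly K[m]} | exists2 i, i \in B & f = 'X_i] p) \/
  (exists2 P, P \in perfect_matchings m & forall c, lists_pairs c P ->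
     forall e, ~ pt_ideal p (minor_poly K (transversal c e))).
Proof.
move=> /fano_coordinates[L [f [X [pX XF]]]].
have := XF _ erefl => {XF} X0.
have [a0 pla0] := has_coordinates_neq0 pX.
have rkX := plucker_neq0_rank pla0.
have [[a Xa]|nX] := pselect (exists a, forall r, X r a = 0).
  left; have [l la [g gE]] := proportional_partner m_gt0 a X0.
  exists [set a; l]%SET; first by rewrite cards2 eq_sym la.
  apply/fano_vars; exists L, f, X; split=> // j; rewrite !inE => /orP[]/eqP-> // r.
  by rewrite gE Xa mulr0.
right; pose r : rel 'I_m :=
  fun a l => `[< exists2 g, g != 0 & forall i, X i l = g * X i a >].
have rP a l : (exists g, forall i, X i l = g * X i a) -> r a l.
  move=> [g gE]; apply/asboolP; exists g => //; apply/eqP => g0.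
  by apply: nX; exists l => i; rewrite gE g0 mul0r.
have r_refl a : r a a by apply: rP; exists 1 => i; rewrite mul1r.
have r_sym a l : r a l -> r l a.
  move=> /asboolP[g g0 gE]; apply: rP; exists g^-1 => i.
  by rewrite gE mulKf.
have r_trans a l j : r a l -> r l j -> r a j.
  move=> /asboolP[g g0 gE] /asboolP[h h0 hE]; apply: rP; exists (h * g) => i.
  by rewrite hE gE mulrA.
have r_equiv : {in [set: 'I_m]%SET & &, equivalence_rel r}.
  move=> a l j _ _ _; split=> // al; apply/idP/idP => [aj|]; last exact: r_trans.
  exact: r_trans (r_sym _ _ al) aj.
pose P := equivalence_partition r [set: 'I_m]%SET.
have Ppart := equivalence_partitionP r_equiv.
have PE B : B \in P -> exists a, B = [set l | r a l]%SET.
  by move=> /imsetP[a _ ->]; exists a; apply/finset.setP => l; rewrite !inE.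
have P_ge2 B : B \in P -> (2 <= #|B|)%N.
  move=> /PE[a ->]; have [l la /rP al] := proportional_partner m_gt0 a X0.
  have <- : #|[set a; l]%SET| = 2%N by rewrite cards2 eq_sym la.
  apply/subset_leq_card/fintype.subsetP => j.
  by case/set2P=> ->; rewrite finset.in_set; [apply: r_refl|apply: al].
(* A selection meeting every class spans all columns. Applied to representatives this bounds the
   number of classes; applied to transversals it gives nonzero minors. *)
have span (l : nat) (s : 'I_l -> 'I_m) :
    (forall B, B \in P -> exists i, s i \in B) -> (n <= \rank (colsub s X))%N.
  move=> sP; rewrite -{1}rkX; apply: spanning_selection => j.
  have /and3P[/eqP Pcov _ _] := Ppart.
  have : j \in finset.cover P by rewrite Pcov inE.
  move=> /finset.bigcupP[B BP jB]; have [i iB] := sP B BP; exists i.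
  by have /asboolP[g _ gE] := same_block r_equiv BP iB jB; exists g.
have P_ge : (n <= #|P|)%N.
  have rep (i : 'I_#|P|) : exists j, j \in enum_val i.
    by have [a ->] := PE _ (enum_valP i); exists a; rewrite inE.
  have [s sP] := choice rep.
  have : (n <= \rank (colsub s X))%N.
    apply: span => B BP; exists (enum_rank_in BP B).
    by have := sP (enum_rank_in BP B); rewrite enum_rankK_in.
  by move/leq_trans; apply; apply: rank_leq_col.
have mE := card_partition Ppart; rewrite cardsT card_ord in mE.
(* A class of three columns, next to at least [n - 1] others of at least two, would exceed [2 * n]
   columns. *)
have P_eq2 B : B \in P -> #|B| = 2%N.
  move=> BP; apply/eqP; rewrite eqn_leq P_ge2 // andbT leqNgt; apply/negP => B3.
  have : (m < \sum_(B in P) #|B|)%N.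
    rewrite (bigD1 B) //=; apply: leq_trans (leq_add B3 (leqnn _)).
    rewrite -addn1 -[3%N]/(2 + 1)%N -addnAC leq_add2r.
    have le2 : (\sum_(A in P) 2 <= 2 + \sum_(A in P | A != B) #|A|)%N.
      rewrite (bigD1 B) //= leq_add2l; apply: leq_sum => A /andP[AP _].
      exact: P_ge2.
    by apply: leq_trans le2; rewrite sum_nat_const mulnC [leqLHS]m2n leq_mul2l P_ge.
  by rewrite -mE ltnn.
exists P => [|c [[c' cK c'K] cP] e].
  by rewrite inE Ppart; apply/forallP => B; apply/implyP => /P_eq2 ->.
apply/(minor_poly_notin _ pX).
have := span _ (transversal c e).
rewrite -unitfE -unitmxE -row_full_unit /row_full eqn_leq.
move=> sp; rewrite rank_leq_row sp // => B /cP[i ->]; exists i.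
by rewrite /transversal !inE; case: (e i); rewrite eqxx ?orbT.
Qed.

End MatchingPoints.

(** * Coordinate components *)

Section ZariskiTopology.
Variables (K : fieldType) (N : nat).
Implicit Types (p q : projPoint K N).

Lemma closed_zeros (J : set {mpoly K[N]}) : closed (zeros J).
Proof. by rewrite -openC; exists J. Qed.

Lemma closed_zerosP (A : set (projPoint K N)) : closed A -> exists J, A = zeros J.
Proof. by rewrite -openC => -[J AJ]; exists J; rewrite -[A]setCK AJ setCK. Qed.

Lemma closed_rational_point p y : has_coordinates p idfun y -> closed [set p].
Proof.
move=> py; have -> : [set p] = zeros (pt_ideal p); last exact: closed_zeros.
by rewrite eqEsubset; split=> [q ->|q] //; apply: (rational_point_max py).
Qed.

(** A closed set containing [p] contains all its specializations, hence all of [Z]. *)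
Lemma irreducible_generic (Z : set (projPoint K N)) p :
  Z p -> (forall q, Z q -> pt_ideal p `<=` pt_ideal q) -> irreducible_set Z.
Proof.
move=> Zp p_gen; split; first by exists p.
move=> _ _ /closed_zerosP[I ->] /closed_zerosP[J ->] ZIJ.
by have [pI|pJ] := ZIJ _ Zp; [left|right] => q /p_gen pq g Jg; apply: pq; auto.
Qed.

End ZariskiTopology.

Section CoordinateComponents.
Variables (n m : nat) (K : fieldType).
Hypotheses (n_gt0 : (0 < n)%N).
Local Notation N := (plucker_dim n m).
Local Notation coordF B :=
  (fano n [set f : {mpoly K[m]} | exists2 i, i \in B & f = 'X_i]).
Implicit Types (B : {set 'I_m}) (p q : projPoint K N) (s : 'I_n -> 'I_m).

Definition generic_avoiding B : 'M[{mpoly K[n * m]}]_(n, m) :=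
  \matrix_(i, j) if j \in B then 0 else 'X_(mxvec_index i j).

Lemma map_generic_avoiding B (A : comNzRingType) (f : {rmorphism K -> A})
    (X : 'M[A]_(n, m)) : (forall j, j \in B -> forall r, X r j = 0) ->
  map_mx (mmap f (mxvec X 0)) (generic_avoiding B) = X.
Proof.
move=> XB; apply/matrixP => i j; rewrite !mxE.
by case: ifP => [/XB->|_]; rewrite ?raddf0 // mmapX mmap1U mxvecE.
Qed.

(** The generic entries specialize to a matrix with the identity on the columns [s] and zeros
    elsewhere, where this minor is 1. *)
Lemma generic_avoiding_minor B s : injective s -> (forall i, s i \notin B) ->
  \det (colsub s (generic_avoiding B)) != 0.
Proof.
move=> s_inj sB; pose E : 'M[K]_(n, m) := \matrix_(i, j) (j == s i)%:R.
have EB j : j \in B -> forall r, E r j = 0.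
  by move=> jB r; rewrite mxE; case: eqP => // js; rewrite js (negPf (sB r)) in jB.
have := det_map_mx (mmap (idfun : {rmorphism K -> K}) (mxvec E 0))
  (colsub s (generic_avoiding B)).
rewrite -map_colsub map_generic_avoiding // => detE.
apply/eqP => d0; have := detE; rewrite d0 raddf0 => /eqP.
have -> : colsub s E = 1%:M.
  by apply/matrixP => i j; rewrite !mxE (inj_eq s_inj) eq_sym.
by rewrite det1 oner_eq0.
Qed.

Lemma selection_avoiding B j : j \notin B -> (n + #|B| <= m)%N ->
  exists s, [/\ injective s, forall i, s i \notin B & exists i, s i = j].
Proof.
move=> jB nB; have nA : (n <= #|~: B|%SET)%N.
  by rewrite -(leq_add2l #|B|) finset.cardsC card_ord addnC.
pose s0 i : 'I_m := enum_val (widen_ord nA i).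
have s0B i : s0 i \notin B by have := enum_valP (widen_ord nA i); rewrite inE.
have s0_inj : injective s0.
  by move=> i i' /enum_val_inj /(congr1 val) /= ii; apply: val_inj.
pose i0 := Ordinal n_gt0.
(* The transposition brings [j] into the image and stays off [B], since both exchanged columns
   do. *)
exists (fun i => tperm (s0 i0) j (s0 i)); split.
- by move=> i i' /perm_inj /s0_inj.
- by move=> i; case: tpermP => //.
- by exists i0; rewrite tpermL.
Qed.

Lemma coordF_minor B p s i : coordF B p -> s i \in B ->
  pt_ideal p (minor_poly K s).
Proof.
move=> /(fano_vars n_gt0)[L [f [X [pX XB]]]] siB; apply: contrapT.
move=> /(minor_poly_notin _ pX)/eqP; apply.
by apply: (det_zero_col (i := i)); apply: XB.
Qed.

(** Every matrix with zero columns at [B] is a specialization of the generic one, so forms vanishing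
    at the latter vanish on all of [coordF B]. *)
Lemma generic_point B : (n + #|B| <= m)%N -> exists p,
  [/\ has_coordinates p (@mpolyC (n * m) K) (tnth (plucker (generic_avoiding B))),
      coordF B p,
      forall q, coordF B q -> pt_ideal p `<=` pt_ideal q
    & forall s, injective s -> (forall i, s i \notin B) ->
        ~ pt_ideal p (minor_poly K s)].
Proof.
move=> nB; have Bm : (#|B| < m)%N by apply: leq_trans nB; rewrite -add1n leq_add2r.
have [j jB] : exists j, j \notin B.
  apply/existsP; rewrite -negb_forall; apply: contraL Bm => /forallP BT.
  by rewrite -leqNgt -[leqLHS]card_ord; apply/subset_leq_card/fintype.subsetP.
have [s0 [s0_inj s0B _]] := selection_avoiding jB nB.
have d0 := generic_avoiding_minor s0_inj s0B.
have y0 : exists a, tnth (plucker (generic_avoiding B)) a != 0.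
  have [a [sigma sE]] := sort_selection s0_inj; exists a.
  apply: contraNneq d0; rewrite tnth_plucker => a0.
  by rewrite (det_colsub_perm _ sE) a0 mulr0.
have [p pX] := point_with_coordinates (@mpolyC (n * m) K) y0.
exists p; split=> //.
- apply: (fano_of_coordinates n_gt0 pX) => _ [i iB ->].
  by rewrite restriction_var; apply/linear_form_eq0 => r; rewrite mxE iB.
- move=> q /(fano_vars n_gt0)[L [f [X [qX XB]]]] h /pX h0; apply/qX => d.
  have /(congr1 (mmap f (mxvec X 0))) := h0 d.
  rewrite raddf0 (rmorph_mmap (mmap f (mxvec X 0))) => E; rewrite -[RHS]E.
  apply: eq_mmap => [c|a] /=; first by rewrite mmapC.
  by rewrite -(plucker_map (mmap f (mxvec X 0))) map_generic_avoiding.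
- move=> s s_inj sB.
  rewrite (has_coordinates_homog pX (minor_poly_homog _ s)) minor_polyE.
  by apply/eqP/generic_avoiding_minor.
Qed.

Lemma coordF_irreducible B : (n + #|B| <= m)%N -> irreducible_set (coordF B).
Proof.
by move=> /generic_point[p [_ Bp p_gen _]]; apply: irreducible_generic p_gen.
Qed.

(** For [j] in [B'] but not in [B], a minor through [j] avoiding [B] vanishes on [coordF B'] but not
    at the generic point of [coordF B]. *)
Lemma coordF_subset B B' : (n + #|B| <= m)%N -> coordF B `<=` coordF B' ->
  B' \subset B.
Proof.
move=> nB BB'; apply/fintype.subsetP => j jB'; apply/negPn/negP => jB.
have [p [_ Bp _ np]] := generic_point nB.
have [s [s_inj sB [i sij]]] := selection_avoiding jB nB.
by apply: (np s s_inj sB); apply: (coordF_minor (i := i) (BB' _ Bp)); rewrite sij.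
Qed.

Lemma coordF_inj B B' : #|B| = #|B'| -> (n + #|B| <= m)%N ->
  coordF B = coordF B' -> B = B'.
Proof.
move=> cB nB BB'; apply/esym/eqP; rewrite eqEcard cB leqnn andbT.
by apply: coordF_subset; rewrite ?BB'.
Qed.

Hypotheses (m2n : m = (2 * n)%N) (two_neq0 : 2%:R != 0 :> K).
Local Notation F := (fano n [set mesym m K m.-1]).

(** Each summand omits a single factor, so one of the zero columns in [B] always remains. *)
Lemma coordF_sub_fano B : (1 < #|B|)%N -> coordF B `<=` F.
Proof.
move=> B2 p /(fano_vars n_gt0)[L [f [X [pX XB]]]].
apply: (fano_of_coordinates n_gt0 pX) => _ ->.
rewrite restriction_mesym ?m2n ?muln_gt0 // big1 // => j _.
have [l /setD1P[lj lB]] : exists l, l \in B :\ j.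
  apply/card_gt0P; move: B2; rewrite (cardsD1 j).
  by case: (j \in B); rewrite ?add1n ?add0n // => /ltnW.
by rewrite (bigD1 l) //= (_ : linear_form X l = 0) ?mul0r //; apply/linear_form_eq0/XB.
Qed.

(** The transversals are finite in number, so the nonvanishing of all their minors is the
    nonvanishing of one product. *)
Lemma matching_open c p : bijective c ->
  has_coordinates p idfun (tnth (plucker (matching_mx K c))) ->
  F `&` ~` zeros [set \prod_(e : {ffun 'I_n -> bool}) minor_poly K (transversal c e)] =
  [set p].
Proof.
move=> c_bij pc; rewrite eqEsubset; split=> q.
  move=> [Fq nq].
  apply: (has_coordinates_uniq (f := idfun)
    (y := tnth (plucker (matching_mx K c)))) => //.
  apply: matching_point_isolated => // e.
  have /pt_ideal_prod/(_ [ffun i => e i] isT) :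
      ~ pt_ideal q (\prod_(e : {ffun 'I_n -> bool}) minor_poly K (transversal c e)).
    by move=> qprod; apply: nq => _ ->.
  suff -> : transversal c [ffun i => e i] = transversal c e by [].
  by apply/funext => i; rewrite /transversal ffunE.
move=> ->; split; first exact: (matching_point_mem n_gt0 m2n c_bij pc).
move=> /(_ _ erefl); apply/pt_ideal_prod => e _.
exact/(minor_poly_notin _ pc)/matching_mx_transversal/bij_inj.
Qed.

Lemma coordF_component B : #|B| = 2%N -> (1 < n)%N ->
  irreducible_component F (coordF B).
Proof.
move=> B2 n2; have nB : (n + #|B| <= m)%N by rewrite B2; lia.
split; first by apply: coordF_sub_fano; rewrite B2.
  exact: coordF_irreducible.
move=> Y [_ Yirr] YF BY; rewrite eqEsubset; split=> //.
have [g [_ Bg _ ng]] := generic_point nB.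
(* If [Y] met the open set of a matching, irreducibility would shrink [Y] to the matching point.
   That point would be [g], where a transversal minor through a column of [B] vanishes. *)
have noY c p : bijective c -> Y p ->
    ~ (forall e : 'I_n -> bool, ~ pt_ideal p (minor_poly K (transversal c e))).
  move=> c_bij Yp pc.
  have pE := matching_point_isolated n_gt0 m2n two_neq0 c_bij (YF _ Yp) pc.
  have := matching_open c_bij pE; set T := [set \prod_e _] => FT.
  have /Yirr : Y `<=` [set p] `|` zeros T.
    move=> q Yq; have [|nTq] := pselect (zeros T q); first by right.
    by left; rewrite -FT; split=> //; apply: YF.
  move=> /(_ (closed_rational_point pE) (@closed_zeros _ _ _)) [Yp1|/(_ _ Yp)].
    have gp : g = p by apply/Yp1/BY.
    have [j jB] : exists j, j \in B by apply/card_gt0P; rewrite B2.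
    have [c' _ c'K] := c_bij.
    apply: (pc (fun=> (c' j).2)); rewrite -gp.
    apply: (coordF_minor (i := (c' j).1) Bg).
    by rewrite /transversal -surjective_pairing c'K.
  move=> /(_ _ erefl); apply/pt_ideal_prod => e _; exact: pc.
(* The product of the minors avoiding [B] is nonzero at [g] but vanishes on every other coordinate
   component. *)
pose S := [pred s : {ffun 'I_n -> 'I_m} | injectiveb s & [forall i, s i \notin B]].
have /Yirr : Y `<=` coordF B `|` zeros [set \prod_(s | S s) minor_poly K s].
  move=> p Yp.
  have [[B' B'2 Bp]|[P Pm Pc]] := fano_classification n_gt0 m2n (YF _ Yp).
    have [<-|BB'] := eqVneq B' B; [by left|right=> _ ->].
    have [j jB' jB] : exists2 j, j \in B' & j \notin B.
      by apply/fintype.subsetPn; apply: contraNN BB' => BB'; rewrite eqEcard BB' B2 B'2.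
    have [s [s_inj sB [i sij]]] := selection_avoiding jB nB.
    apply: contrapT; move/pt_ideal_prod => /(_ [ffun i => s i]); apply.
      apply/andP; split; last by apply/forallP => l; rewrite ffunE.
      by apply/injectiveP => l l'; rewrite !ffunE => /s_inj.
    by apply: (coordF_minor (i := i) Bp); rewrite ffunE sij.
  have [c cP] := matching_pairs m2n Pm.
  by case: (noY c p cP.1 Yp) => e; apply: Pc.
move=> /(_ (@closed_zeros _ _ _) (@closed_zeros _ _ _)) [//|].
move=> /(_ _ (BY _ Bg))/(_ _ erefl) gS.
exfalso; move: gS; apply/pt_ideal_prod => s /andP[/injectiveP s_inj /forallP sB].
exact: ng.
Qed.

End CoordinateComponents.

(** * Coordinate components are Grassmannians *)

Section CoordinateGrassmannian.
Variables (n m r : nat) (K : fieldType) (B : {set 'I_m}) (sig : 'I_r -> 'I_m).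
Hypotheses (n_gt0 : (0 < n)%N)
  (sig_ltn : forall i j : 'I_r, (i < j)%N -> (sig i < sig j)%N)
  (sigP : forall j, j \notin B <-> exists i, sig i = j).
Local Notation coordF :=
  (fano n [set f : {mpoly K[m]} | exists2 i, i \in B & f = 'X_i]).

Lemma sig_inj : injective sig.
Proof.
move=> i j sij; apply/val_inj; case: (ltngtP i j) => // /sig_ltn.
all: by rewrite sij ltnn.
Qed.

Lemma sig_leq i j : (sig i < sig j)%N -> (i < j)%N.
Proof.
move=> sij; rewrite ltnNge; apply/negP.
rewrite leq_eqVlt => /orP[/eqP/val_inj ji|/sig_ltn].
  by rewrite ji ltnn in sij.
by rewrite ltnNge ltnW.
Qed.

(** Since [sig] lists the columns outside [B] in increasing order, composition with it carries
    increasing selections onto those avoiding [B], without any signs. *)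
Lemma plucker_lift : exists iota : 'I_(plucker_dim n r) -> 'I_(plucker_dim n m),
  [/\ injective iota,
        forall (a : 'I_(plucker_dim n r)) i, enum_val (iota a) i = sig (enum_val a i)
    & forall b : 'I_(plucker_dim n m), (forall i, enum_val b i \notin B) ->
        exists a, iota a = b].
Proof.
have idxP k l (a : 'I_(plucker_dim k l)) (i j : 'I_k) :
    (i < j)%N -> (enum_val a i < enum_val a j)%N.
  have := enum_valP a; rewrite inE => /'forall_forallP /(_ i j) /implyP; exact.
have mkidx k l (t : {ffun 'I_k -> 'I_l}) :
    (forall i j : 'I_k, (i < j)%N -> (t i < t j)%N) ->
    exists a : 'I_(plucker_dim k l), enum_val a = t.
  move=> tmono; have tP : t \in plucker_idx k l.
    by rewrite inE; apply/'forall_forallP => i j; apply/implyP/tmono.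
  by exists (enum_rank_in tP t); rewrite enum_rankK_in.
have /choice[iota iotaE] : forall a : 'I_(plucker_dim n r),
    exists b : 'I_(plucker_dim n m), forall i, enum_val b i = sig (enum_val a i).
  move=> a; have [|b bE] := mkidx n m [ffun i => sig (enum_val a i)].
    by move=> i j ij; rewrite !ffunE; apply/sig_ltn/idxP.
  by exists b => i; rewrite bE ffunE.
exists iota; split=> // [a a' aa'|b bB].
  apply/enum_val_inj/ffunP => i; apply: sig_inj.
  by rewrite -!iotaE aa'.
have /choice[t tE] : forall i, exists j, sig j = enum_val b i.
  by move=> i; apply/sigP/bB.
have [|a aE] := mkidx n r [ffun i => t i].
  by move=> i j ij; rewrite !ffunE; apply/sig_leq; rewrite !tE; apply: idxP.
exists a; apply/enum_val_inj/ffunP => i.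
by rewrite iotaE aE ffunE tE.
Qed.

(** Without equations the Stiefel ideal is zero; viewed this way, the points of the Grassmannian are
    also described by matrices through [fano_vars]. *)
Lemma grassmannianE : grassmannian K n r =
  fano n [set f : {mpoly K[r]} |
    exists2 i, i \in (finset.set0 : {set 'I_r}) & f = 'X_i].
Proof.
rewrite /grassmannian /fano; congr zeros; rewrite eqEsubset; split=> h.
  by move=> h0; exists [::] => //; rewrite big_nil h0.
move=> [[|u s] sG hE]; first by rewrite /plucker_ideal /= hE big_nil.
by have [f [i]] := sG u (mem_head _ _); rewrite inE.
Qed.

Lemma pt_ideal_coordinates N (p : projPoint K N) (L : comNzRingType)
    (f : {rmorphism K -> L}) (y : 'I_N -> L) h : has_coordinates p f y ->
  pt_ideal p h <-> mmap (@polyC L \o f) (fun b => 'X * (y b)%:P) h = 0.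
Proof. by move=> py; rewrite py; split=> /mmap_scaleX_eq0. Qed.

(* Both maps are linear in the Plucker coordinates: the projection to the minors
   avoiding [B], and the extension by zero. *)
Lemma coordF_grassmannian_iso : reduced_iso coordF (grassmannian K n r).
Proof.
have [iota [iota_inj iotaE iotaP]] := plucker_lift.
rewrite grassmannianE; set Z := coordF; set W := fano n _.
have pl_iota (L : fieldType) (X : 'M[L]_(n, m)) a :
    tnth (plucker X) (iota a) = tnth (plucker (colsub sig X)) a.
  rewrite !tnth_plucker; congr (\det _).
  by apply/matrixP => i j; rewrite !mxE iotaE.
have pl_out (L : fieldType) (X : 'M[L]_(n, m)) b :
    (forall j, j \in B -> forall i, X i j = 0) -> (forall a, iota a != b) ->
    tnth (plucker X) b = 0.
  move=> XB nb; rewrite tnth_plucker; apply: contrapT => d0.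
  have [i|a ab] := iotaP b; last by have := nb a; rewrite ab eqxx.
  apply/negP => /XB Xb; apply: d0; exact: (det_zero_col (i := i)).
have ZW q : Z q -> exists (L : fieldType) (f : {rmorphism K -> L}) (X : 'M[L]_(n, m)) p,
    [/\ has_coordinates q f (tnth (plucker X)),
        forall b, (forall a, iota a != b) -> tnth (plucker X) b = 0, W p
      & has_coordinates p f (tnth (plucker (colsub sig X)))].
  move=> /(fano_vars n_gt0)[L [f [X [qX XB]]]].
  have [b Xb] := has_coordinates_neq0 qX.
  have [a ab] : exists a, iota a = b.
    apply: contrapT => nb; move/eqP: Xb; apply; apply: pl_out => // a.
    by apply/eqP => ab; apply: nb; exists a.
  have [|p pX] := @point_with_coordinates K _ L f (tnth (plucker (colsub sig X))).
    by exists a; rewrite -pl_iota ab.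
  exists L, f, X, p; split=> // [b' nb'|]; first exact: pl_out.
  by apply/(fano_vars n_gt0); exists L, f, (colsub sig X); split=> // j; rewrite inE.
have WZ q : W q -> exists (L : fieldType) (f : {rmorphism K -> L}) (X : 'M[L]_(n, m)) p,
    [/\ has_coordinates q f (tnth (plucker (colsub sig X))),
        forall b, (forall a, iota a != b) -> tnth (plucker X) b = 0, Z p
      & has_coordinates p f (tnth (plucker X))].
  move=> /(fano_vars n_gt0)[L [f [X [qX _]]]].
  (* Right multiplication by this 0-1 matrix inserts zero columns at the places of [B]. *)
  pose X' : 'M[L]_(n, m) := X *m \matrix_(i, j) (sig i == j)%:R.
  have X'X : colsub sig X' = X.
    rewrite colsub_mul -[RHS]mulmx1; congr (_ *m _).
    by apply/matrixP => i j; rewrite !mxE (inj_eq sig_inj).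
  have X'B j : j \in B -> forall i, X' i j = 0.
    move=> jB i; rewrite mxE big1 // => l _; rewrite mxE.
    case: eqP => [lj|]; last by rewrite mulr0.
    have /sigP : exists i, sig i = j by exists l.
    by rewrite jB.
  have [a Xa] := has_coordinates_neq0 qX.
  have [|p pX] := @point_with_coordinates K _ L f (tnth (plucker X')).
    by exists (iota a); rewrite pl_iota X'X.
  exists L, f, X', p; split=> // [|b nb|]; [by rewrite X'X|exact: pl_out|].
  by apply/(fano_vars n_gt0); exists L, f, X'.
pose phi : (plucker_dim n r).-tuple {mpoly K[plucker_dim n m]} :=
  [tuple 'X_(iota a) | a < plucker_dim n r].
pose psi : (plucker_dim n m).-tuple {mpoly K[plucker_dim n r]} :=
  [tuple if [pick a | iota a == b] is Some a then 'X_a else 0 | b < plucker_dim n m].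
have psi_iota a : tnth psi (iota a) = 'X_a.
  rewrite tnth_mktuple; case: pickP => [a' /eqP/iota_inj -> //|/(_ a)].
  by rewrite eqxx.
have psi_out b : (forall a, iota a != b) -> tnth psi b = 0.
  by move=> nb; rewrite tnth_mktuple; case: pickP => // a; rewrite (negPf (nb a)).
have iota_dec b : (exists a, iota a = b) \/ (forall a, iota a != b).
  have [?|nb] := pselect (exists a, iota a = b); [by left|right=> a].
  by apply/eqP => ab; apply: nb; exists a.
have Z_out q b : Z q -> (forall a, iota a != b) -> pt_ideal q 'X_b.
  move=> /ZW[L [f [X [_ [qX Xout _ _]]]]] nb.
  apply/(pt_ideal_coordinates _ qX).
  by rewrite mmapX mmap1U Xout // mulr0.
exists [set phi], [set psi]; split.
- split=> [_ ->|p Zp|_ _ -> -> i j p _|_ h -> Wh q Zq].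
  + by exists 1%N => a; rewrite tnth_mktuple dhomogX /= mdeg1.
  + exists phi => //; have [b pb] := pt_ideal_relevant p.
    have [[a ab]|/(Z_out p b Zp)//] := iota_dec b.
    by exists a; rewrite tnth_mktuple ab.
  + by rewrite mulrC subrr; apply: pt_ideal0.
  + have [L [f [X [p [qX _ Wp pX]]]]] := ZW q Zq.
    apply/(pt_ideal_coordinates _ qX).
    have /(pt_ideal_coordinates _ pX) E := Wh p Wp.
    rewrite mmap_mPo -[RHS]E; apply: eq_mmap => // a.
    by rewrite tnth_mktuple mmapX mmap1U pl_iota.
- split=> [_ ->|p Wp|_ _ -> -> i j p _|_ h -> Zh q Wq].
  + exists 1%N => b; rewrite tnth_mktuple; case: pickP => [a _|_]; last exact: dhomog0.
    by rewrite dhomogX /= mdeg1.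
  + exists psi => //; have [a pa] := pt_ideal_relevant p.
    by exists (iota a); rewrite psi_iota.
  + by rewrite mulrC subrr; apply: pt_ideal0.
  + have [L [f [X [p [qX Xout Zp pX]]]]] := WZ q Wq.
    apply/(pt_ideal_coordinates _ qX).
    have /(pt_ideal_coordinates _ pX) E := Zh p Zp.
    rewrite mmap_mPo -[RHS]E; apply: eq_mmap => // b.
    have [[a <-]|nb] := iota_dec b; first by rewrite psi_iota mmapX mmap1U pl_iota.
    by rewrite psi_out // raddf0 Xout // mulr0.
- move=> _ _ -> -> i j p Zp.
  have psiE b : pt_ideal p ((tnth psi b \mPo phi) - 'X_b).
    have [[a <-]|nb] := iota_dec b.
      by rewrite psi_iota comp_mpolyXU -tnth_nth tnth_mktuple subrr; apply: pt_ideal0.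
    rewrite psi_out // raddf0; apply: pt_idealB; [exact: pt_ideal0|exact: Z_out].
  rewrite (_ : _ - _ = 'X_j * ((tnth psi i \mPo phi) - 'X_i) -
    'X_i * ((tnth psi j \mPo phi) - 'X_j)); last by ring.
  by apply: pt_idealB; apply: pt_idealMl.
- move=> _ _ -> -> i j p _.
  rewrite !tnth_mktuple !comp_mpolyXU -!tnth_nth !psi_iota mulrC subrr.
  exact: pt_ideal0.
Qed.

End CoordinateGrassmannian.

(** * Counting perfect matchings *)

Section CountMatchings.
Variable T : finType.
Implicit Types (S : {set T}) (P Q : {set {set T}}).

Definition pairings S : {set {set {set T}}} :=
  [set P : {set {set T}} | finset.partition P S & [forall B in P, #|B| == 2%N]]%SET.

(** Removing the pair and adding it back are inverse to each other. *)
Lemma card_pairings_with S (x y : T) : x != y -> x \in S -> y \in S ->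
  #|[set P in pairings S | [set x; y] \in P]%SET| =
  #|pairings (S :\: [set x; y])%SET|.
Proof.
move=> xy xS yS; set B := [set x; y]%SET; set S' := (S :\: B)%SET.
have BS : B \subset S by apply/fintype.subsetP => z /set2P[]->.
have B0 : B != finset.set0 by apply/finset.set0Pn; exists x; rewrite !inE eqxx.
have BS' : disjoint (mem B) (mem S').
  rewrite disjoint_sym finset.disjoints_subset.
  by rewrite /S' finset.setDE finset.subsetIr.
have notin Q : Q \in pairings S' -> B \notin Q.
  rewrite inE => /andP[/and3P[/eqP Qcov _ _] _]; apply/negP => BQ.
  have : x \in finset.cover Q by apply/finset.bigcupP; exists B; rewrite // !inE eqxx.
  by rewrite Qcov !inE eqxx.
have U_inj : {in pairings S' &, injective (fun Q => (B |: Q)%SET)}.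
  move=> Q Q' Qm Q'm QQ'.
  by rewrite -(finset.setU1K (notin _ Qm)) QQ' (finset.setU1K (notin _ Q'm)).
rewrite -(card_in_imset U_inj).
congr #|pred_of_set _|; apply/finset.setP => P; apply/setIdP/imsetP => [[]|[Q Qm ->]].
  rewrite inE => /andP[Ppart P2] BP; exists (P :\ B)%SET; last by rewrite finset.setD1K.
  rewrite inE partitionD1 //=; apply/forallP => A; apply/implyP => /setD1P[_ AP].
  by move/forallP/(_ A)/implyP: P2; apply.
split; last by rewrite !inE eqxx.
move: Qm; rewrite !inE => /andP[Qpart Q2]; apply/andP; split.
  have -> : S = (B :|: S')%SET.
    apply/finset.setP => z; rewrite finset.in_setU finset.in_setD.
    by have [/(fintype.subsetP BS)|] := boolP (z \in B).
  exact: partitionU1.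
apply/forallP => A; apply/implyP => /setU1P[->|AQ]; first by rewrite cards2 xy.
by move/forallP/(_ A)/implyP: Q2; apply.
Qed.

(** Each pairing contains exactly one pair through a fixed [x]. Counting by the partner of [x] gives
    [2 * k + 1] choices in the inductive step, each leaving [2 * k] elements. *)
Lemma card_pairings k S : #|S| = (2 * k)%N -> #|pairings S| = double_fact (2 * k).-1.
Proof.
elim: k S => [|k IH] S cS.
  rewrite muln0 in cS *; move/eqP: cS; rewrite cards_eq0 => /eqP ->.
  rewrite (_ : pairings _ = [set finset.set0]%SET) ?cards1 //.
  apply/finset.setP => P; rewrite !inE finset.partition_set0; case: eqP => //= ->.
  by apply/forallP => B; rewrite inE.
(* At [k = 0] the predecessor truncates to 0, and both sides equal 1. *)
have -> : double_fact (2 * k.+1).-1 = ((2 * k).+1 * double_fact (2 * k).-1)%N.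
  have -> : (2 * k.+1).-1 = (2 * k).+1 by lia.
  by case: k {IH cS}.
have [x xS] : exists x, x \in S by apply/card_gt0P; rewrite cS mulnS.
have -> : #|pairings S| =
    (\sum_(P in pairings S) \sum_(y in S :\ x) ([set x; y]%SET \in P))%N.
  rewrite -sum1_card; apply: eq_bigr => P; rewrite inE => /andP[Ppart /forallP P2].
  have /and3P[/eqP Pcov Ptriv _] := Ppart.
  have xP : x \in finset.cover P by rewrite Pcov.
  have xB : x \in finset.pblock P x by rewrite finset.mem_pblock.
  have BP : finset.pblock P x \in P by rewrite finset.pblock_mem.
  have /cards2P[u [v [uv Buv]]] : #|finset.pblock P x| == 2%N.
    by move/implyP: (P2 (finset.pblock P x)); apply.
  have [y yx By] : exists2 y, y != x & finset.pblock P x = [set x; y]%SET.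
    move: xB; rewrite Buv => /set2P[] ->; first by exists v; rewrite // eq_sym.
    by exists u; rewrite // finset.setUC.
  rewrite (bigD1 y) /=; last first.
    rewrite !inE yx -Pcov; apply/finset.bigcupP; exists (finset.pblock P x) => //.
    by rewrite By !inE eqxx orbT.
  rewrite -By BP big1 // => z /andP[/setD1P[zx _] zy].
  case: (boolP (_ \in P)) => // zP; exfalso; move/eqP: zy; apply.
  have := finset.def_pblock Ptriv zP (finset.set21 x z).
  rewrite By => /finset.setP/(_ z).
  by rewrite !inE eqxx orbT (negPf zx) /= => /eqP.
rewrite exchange_big /=.
rewrite (eq_bigr (fun=> double_fact (2 * k).-1)) => [|y /setD1P[yx yS]].
  rewrite sum_nat_const; have := cardsD1 x S; rewrite cS xS => cSx.
  by have -> : #|(S :\ x)%SET| = (2 * k).+1 by lia.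
rewrite -(IH (S :\: [set x; y])%SET); last first.
  rewrite cardsDS ?cS ?cards2 1?eq_sym ?yx ?mulnS ?addKn //.
  by apply/fintype.subsetP => z /set2P[]->.
rewrite -card_pairings_with 1?eq_sym // -sum1_card big_mkcond [RHS]big_mkcond /=.
apply: eq_bigr => P _; rewrite !inE.
by case: (_ && _) => //=; case: (_ \in P).
Qed.

End CountMatchings.

(** The even numbers up to [2 * n] multiply to [2 ^ n] times the factorial of [n]; the odd ones give
    the double factorial. *)
Lemma double_fact_fact n :
  (double_fact (2 * n).-1 * (2 ^ n * n`!))%N = (2 * n)`!.
Proof.
elim: n => [//|n IH]; rewrite mulnS !factS -IH expnS.
case: n {IH} => [//|n]; rewrite mulnS /=; nia.
Qed.

(** * Row spaces of the matching matrices *)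

Section MatchingSpace.
Variables (n m : nat) (K : fieldType) (c : 'I_n * bool -> 'I_m) (P : {set {set 'I_m}}).
Hypothesis cP : lists_pairs c P.

Let c_inj : injective c. Proof. exact/bij_inj/cP.1. Qed.

Lemma sum_indicator_pair (v : 'I_m -> K) i :
  \sum_j v j * indicator_col K [set c (i, true); c (i, false)]%SET j 0 =
  v (c (i, true)) + v (c (i, false)).
Proof.
have tf : c (i, true) != c (i, false) by rewrite (inj_eq c_inj) xpair_eqE andbF.
rewrite (bigD1 (c (i, true))) //= (bigD1 (c (i, false))) 1?eq_sym //=.
rewrite !mxE !inE !eqxx orbT !mulr1 big1 ?addr0 // => j /andP[jt jf].
by rewrite mxE !inE (negPf jt) (negPf jf) mulr0.
Qed.

Lemma matching_mx_space : (matching_mx K c == matching_space K P)%MS.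
Proof.
apply/andP; split.
  apply/sub_bigcapmxP => B /cP.2[i ->]; apply/sub_kermxP/matrixP => l z.
  rewrite !mxE (ord1 z) sum_indicator_pair !(matching_mxE _ c_inj) /=.
  by case: ifP => _; rewrite ?addr0 // expr1 subrr.
apply/rV_subP => v /sub_bigcapmxP vP.
have vE i : v 0 (c (i, false)) = - v 0 (c (i, true)).
  have /vP/sub_kermxP/matrixP/(_ 0 0) : [set c (i, true); c (i, false)]%SET \in P.
    by apply/cP.2; exists i.
  rewrite !mxE sum_indicator_pair => /eqP; rewrite addrC addr_eq0 => /eqP //.
(* The matching matrix is the identity on the columns [c (i, true)], so the entries of [v] there are
   its coefficients on the rows. *)
have -> : v = (\row_i v 0 (c (i, true))) *m matching_mx K c; last exact: submxMl.
have [[c' cK c'K] _] := cP; apply/rowP => j; rewrite -(c'K j); case: (c' j) => i e.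
rewrite mxE (bigD1 i) //= big1 ?addr0 => [|l li]; last first.
  by rewrite (matching_mxE _ c_inj) eq_sym (negPf li) mulr0.
rewrite (matching_mxE _ c_inj) /= eqxx mxE; case: e; first by rewrite mulr1.
by rewrite vE expr1 mulrN1.
Qed.

Lemma matching_is_point p :
  has_coordinates p idfun (tnth (plucker (matching_mx K c))) ->
  is_point_of n (matching_space K P) p.
Proof.
move=> pc; exists (matching_mx K c); split.
- have [a a0] := has_coordinates_neq0 pc.
  exact/eqP/(plucker_neq0_rank a0).
- exact: matching_mx_space.
- by rewrite eqEsubset; split=> h /pc.
Qed.

End MatchingSpace.

(** If a pair of [P] were split by [P'], some transversal of [c'] would contain both its members.
    The minor is then nonzero for [c'], but zero for [c], whose two columns are opposite. *)
Lemma matching_point_sub n m (K : fieldType) c c' (P P' : {set {set 'I_m}})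
    (p : projPoint K (plucker_dim n m)) :
  lists_pairs c P -> lists_pairs c' P' ->
  has_coordinates p idfun (tnth (plucker (matching_mx K c))) ->
  has_coordinates p idfun (tnth (plucker (matching_mx K c'))) ->
  P \subset P'.
Proof.
move=> [c_bij cP] [c'_bij cP'] pc pc'.
have [d dK d'K] := c'_bij; have c_inj := bij_inj c_bij.
apply/fintype.subsetP => B /cP[i ->]; apply/cP'.
have [de|dne] := eqVneq (d (c (i, true))).1 (d (c (i, false))).1.
  exists (d (c (i, true))).1; have : d (c (i, true)) != d (c (i, false)).
    by rewrite (can_eq d'K) (inj_eq c_inj) xpair_eqE andbF.
  rewrite -{2}(d'K (c (i, true))) -{2}(d'K (c (i, false))).
  case: (d _) (d _) de => [i1 e1] [i2 e2] /= ->; rewrite xpair_eqE eqxx /=.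
  by case: e1 e2 => -[] //= _; rewrite finset.setUC.
pose e := [eta (fun=> true) with (d (c (i, true))).1 |-> (d (c (i, true))).2,
                                 (d (c (i, false))).1 |-> (d (c (i, false))).2].
have et : transversal c' e (d (c (i, true))).1 = c (i, true).
  by rewrite /transversal /e /= eqxx -surjective_pairing d'K.
have ef : transversal c' e (d (c (i, false))).1 = c (i, false).
  by rewrite /transversal /e /= eqxx eq_sym (negPf dne) -surjective_pairing d'K.
have : ~ pt_ideal p (minor_poly K (transversal c' e)).
  exact/(minor_poly_notin _ pc')/matching_mx_transversal/bij_inj.
move=> /(minor_poly_notin _ pc)/eqP; case.
apply: (det_proportional_cols (c := -1) dne) => r.
rewrite et ef !(matching_mxE _ c_inj) /=.
by case: ifP => _; rewrite ?mulr0 // expr0 expr1 mulr1.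
Qed.

(** * Isolated matching points and coordinate components over the reals *)

Theorem proposition5p3 (R : realType) (n m : nat) (hn : (2 <= n)%N)
    (hm : m = (2 * n)%N) :
  let F : set (projPoint R (plucker_dim n m)) :=
    fano n [set mesym m R m.-1] in
  let coordF (B : {set 'I_m}) : set (projPoint R (plucker_dim n m)) :=
    fano n [set f | exists2 i, i \in B & f = 'X_i] in
  [/\ #|perfect_matchings m| = double_fact m.-1,
      (double_fact m.-1 * (2 ^ n * n`!))%N = m`!,
      exists pt : {set {set 'I_m}} -> projPoint R (plucker_dim n m),
        {in perfect_matchings m &, injective pt} /\
        forall P, P \in perfect_matchings m ->
          [/\ is_point_of n (matching_space R P) (pt P),
              closed [set pt P] & isolated F (pt P)],
      #|[set B : {set 'I_m} | #|B| == 2%N]%SET| = 'C(m, 2)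
    & {in [set B : {set 'I_m} | #|B| == 2%N]%SET &, injective coordF} /\
      forall B : {set 'I_m}, #|B| = 2%N ->
        irreducible_component F (coordF B) /\
        reduced_iso (coordF B) (grassmannian R n (m - 2))].
Proof.
move=> F coordF.
have n_gt0 : (0 < n)%N by lia.
have two0 : 2%:R != 0 :> R by rewrite Num.Theory.pnatr_eq0.
have card_pm : #|perfect_matchings m| = double_fact m.-1.
  by rewrite hm; apply: card_pairings; rewrite cardsT card_ord.
split=> //; first by rewrite [in m.-1]hm [in m`!]hm double_fact_fact.
- have pt_ex P : P \in perfect_matchings m ->
      exists (c : 'I_n * bool -> 'I_m) p, lists_pairs c P /\
      has_coordinates p (idfun : {rmorphism R -> R}) (tnth (plucker (matching_mx R c))).
    move=> /(matching_pairs hm)[c cP]; exists c.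
    have [p pc] := point_with_coordinates (idfun : {rmorphism R -> R})
      (matching_mx_neq0 R (bij_inj cP.1)).
    by exists p.
  (* The positive count yields a matching, whose point is the default value of [pt] off the perfect
     matchings. *)
  have [P0 P0m] : exists P, P \in perfect_matchings m.
    by apply/card_gt0P; rewrite card_pm -(ltn_pmul2r (m := 2 ^ n * n`!)) ?mul0n;
      rewrite ?[in m.-1]hm ?double_fact_fact ?fact_gt0 // muln_gt0 expn_gt0 fact_gt0.
  have [_ [p0 _]] := pt_ex _ P0m.
  have /choice[pt ptP] P : exists p, P \in perfect_matchings m ->
      exists2 c : 'I_n * bool -> 'I_m, lists_pairs c P &
      has_coordinates p (idfun : {rmorphism R -> R}) (tnth (plucker (matching_mx R c))).
    have [/pt_ex[c [p [cP pc]]]|] := boolP (P \in perfect_matchings m).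
      by exists p => _; exists c.
    by exists p0.
  exists pt; split=> [P P' Pm P'm PP'|P Pm].
    have [c cP pc] := ptP _ Pm; have [c' cP' pc'] := ptP _ P'm.
    rewrite -PP' in pc'; apply/eqP; rewrite eqEcard (matching_point_sub cP cP' pc pc').
    by rewrite (card_matching hm Pm) (card_matching hm P'm) leqnn.
  have [c cP pc] := ptP _ Pm; split.
  + exact: matching_is_point pc.
  + exact: closed_rational_point pc.
  + have FU := matching_open n_gt0 hm two0 cP.1 pc.
    split; first by apply/mem_set/(matching_point_mem n_gt0 hm cP.1 pc).
    exists (~` zeros
      [set \prod_(e : {ffun 'I_n -> bool}) minor_poly R (transversal c e)]).
      apply: open_nbhs_nbhs; split; first by rewrite openC; apply: closed_zeros.
      by have : [set pt P] (pt P) by []; rewrite -{1}FU => -[].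
    by rewrite setIC.
- by rewrite card_draws card_ord.
split=> [B B'|B B2].
  rewrite !finset.inE => /eqP B2 /eqP B'2.
  by apply: (coordF_inj n_gt0); rewrite B2 //; lia.
split; first exact: coordF_component.
have cB : #|~: B|%SET = (m - 2)%N by have := finset.cardsC B; rewrite card_ord B2; lia.
pose sig (i : 'I_(m - 2)) : 'I_m := enum_val (cast_ord (esym cB) i).
have sig_ltn (i j : 'I_(m - 2)) : (i < j)%N -> (sig i < sig j)%N.
  by move=> ij; apply: enum_val_ltn.
have sigP j : j \notin B <-> exists i, sig i = j.
  split=> [jB|[i <-]].
    have jB' : j \in (~: B)%SET by rewrite finset.inE.
    by exists (cast_ord cB (enum_rank_in jB' j)); rewrite /sig cast_ordK enum_rankK_in.
  by have := enum_valP (cast_ord (esym cB) i); rewrite finset.inE.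
exact: (coordF_grassmannian_iso R n_gt0 sig_ltn sigP).
Qed.
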